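(* Let $k$ be an algebraically closed field and $H$ a finite-dimensional Hopf algebra over $k$. The two assignments (a) $J\mapsto H^{(J)}$, sending a twist $J$ for $H$ to the left $H$-module coalgebra $H^{(J)}$, and (b) $C\mapsto J:=(i\otimes i)\Delta_C(i^{-1}(1))\in H\otimes H$ (rescaled by a non-zero scalar so as to be normalized), where $i:C\to H$ is an isomorphism of left $H$-modules onto the left regular $H$-module, define a one-to-one correspondence between: 1. gauge equivalence classes of twists for $H$, and 2. isomorphism classes of left $H$-module coalgebras $C$ which are isomorphic to the left regular $H$-module as $H$-modules and such that the corresponding $H^*$-extension $k\subset C^*$ is Galois.
   Context: Let $\Delta,\varepsilon$ be the comultiplication and counit of $H$. A twist for $H$ is an invertible $J\in H\otimes H$ with $(\Delta\otimes\mathrm{id})(J)(J\otimes 1)=(\mathrm{id}\otimes\Delta)(J)(1\otimes J)$. Then $c=(\varepsilon\otimes\mathrm{id})(J)=(\mathrm{id}\otimes\varepsilon)(J)$ is a non-zero scalar, and twists are always assumed normalized so that $c=1$ (replacing $J$ by $c^{-1}J$). Two twists $J,J'$ are gauge equivalent if $J'=\Delta(x)J(x^{-1}\otimes x^{-1})$ for some invertible $x\in H$ with $\varepsilon(x)=1$. A left $H$-module coalgebra is a coalgebra $(C,\Delta_C,\varepsilon_C)$ which is a left $H$-module with $\Delta_C(h\cdot c)=\Delta(h)\cdot\Delta_C(c)$ and $\varepsilon_C(h\cdot c)=\varepsilon(h)\varepsilon_C(c)$. For a twist $J$, $H^{(J)}$ is the left regular $H$-module $H$ with comultiplication $c\mapsto\Delta(c)J$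 and counit $\varepsilon$; it is a left $H$-module coalgebra. Isomorphisms of $H$-module coalgebras are $H$-linear coalgebra isomorphisms. For a left $H$-module coalgebra $C$, the dual algebra $A=C^*$ is a left $H^*$-comodule algebra: the coaction $\gamma:A\to H^*\otimes A$, $\gamma(a)=a_{(-1)}\otimes a_{(0)}$, is determined by $\langle a,h\cdot c\rangle=\langle a_{(-1)},h\rangle\langle a_{(0)},c\rangle$ for $h\in H$, $c\in C$. The $H^*$-extension $k\subset A$ is Galois if the coinvariants $\{a\in A:\gamma(a)=1\otimes a\}$ equal $k$ and the map $A\otimes_k A\to H^*\otimes_k A$, $a\otimes b\mapsto(1\otimes a)\gamma(b)$, is bijective. *)

(* Defs.v *)
From HB Require Import structures.
From mathcomp Require Import all_boot all_order all_algebra all_field.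

Set Implicit Arguments.
Unset Strict Implicit.
Unset Printing Implicit Defensive.

Import GRing.Theory.
Local Open Scope ring_scope.

Reserved Notation "v *t w" (at level 40, left associativity).

(** [tensor V W] is the space of coordinate matrices with respect to the bases
    [vbasis {:V}] and [vbasis {:W}]; [tliftE] and [tensor_hom_ext] below are
    its universal property. *)

Definition tensor (K : fieldType) (V W : vectType K) : Type :=
  'M[K]_(\dim {:V}, \dim {:W}).

HB.instance Definition _ (K : fieldType) (V W : vectType K) :=
  Vector.copy (tensor V W) 'M[K]_(\dim {:V}, \dim {:W}).

Definition tens (K : fieldType) (V W : vectType K) (v : V) (w : W) :
    tensor V W :=
  \matrix_(i, j) (coord (vbasis {:V}) i v * coord (vbasis {:W}) j w).

Notation "v *t w" := (tens v w) : ring_scope.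

Definition bilin (K : fieldType) (V W U : vectType K) (f : V -> W -> U) :=
  (forall w, linear (f^~ w)) /\ (forall v, linear (f v)).

Section Tensor.
Variables (K : fieldType) (V W U : vectType K).

Definition tlift_fun (f : V -> W -> U) (t : tensor V W) : U :=
  \sum_i \sum_j (t : 'M_(_, _)) i j *: f (vbasis {:V})`_i (vbasis {:W})`_j.

Fact tlift_fun_linear f : linear (tlift_fun f).
Proof.
move=> a s t; rewrite /tlift_fun scaler_sumr -big_split; apply: eq_bigr => i _.
rewrite scaler_sumr -big_split; apply: eq_bigr => j _ /=.
by rewrite !mxE scalerDl scalerA.
Qed.
HB.instance Definition _ f :=
  GRing.isLinear.Build K (tensor V W) U _ (tlift_fun f) (tlift_fun_linear f).

Definition tlift (f : V -> W -> U) : 'Hom(tensor V W, U) :=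
  linfun (tlift_fun f).

Lemma tens_bilin : bilin (@tens K V W).
Proof.
split=> [w a v v'|v a w w']; apply/matrixP => i j; rewrite !mxE linearP.
  by rewrite /= mulrDl mulrA.
by rewrite /= mulrDr mulrCA.
Qed.

Lemma tensDl v v' (w : W) : (v + v' : V) *t w = v *t w + v' *t w.
Proof. by have := tens_bilin.1 w 1 v v'; rewrite !scale1r. Qed.
Lemma tensDr (v : V) (w w' : W) : v *t (w + w') = v *t w + v *t w'.
Proof. by have := tens_bilin.2 v 1 w w'; rewrite !scale1r. Qed.
Lemma tens0l w : (0 : V) *t w = 0 :> tensor V W.
Proof. by apply/matrixP => i j; rewrite !mxE linear0 mul0r. Qed.
Lemma tens0r v : v *t (0 : W) = 0 :> tensor V W.
Proof. by apply/matrixP => i j; rewrite !mxE linear0 mulr0. Qed.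
Lemma tensZl a (v : V) (w : W) : (a *: v) *t w = a *: (v *t w).
Proof. by have := tens_bilin.1 w a v 0; rewrite !addr0 tens0l addr0. Qed.
Lemma tensZr a (v : V) (w : W) : v *t (a *: w) = a *: (v *t w).
Proof. by have := tens_bilin.2 v a w 0; rewrite !addr0 tens0r addr0. Qed.

Lemma coord_vbasisE (X : vectType K) (v : X) :
  v = \sum_i coord (vbasis {:X}) i v *: (vbasis {:X})`_i.
Proof. by apply: coord_vbasis; rewrite memvf. Qed.

Lemma tliftE (f : V -> W -> U) v w : bilin f -> tlift f (v *t w) = f v w.
Proof.
move=> [fl fr].
pose fL w := HB.pack_for {linear V -> U} (f^~ w)
  (GRing.isLinear.Build K V U _ (f^~ w) (fl w)).
pose fR v := HB.pack_for {linear W -> U} (f v)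
  (GRing.isLinear.Build K W U _ (f v) (fr v)).
rewrite lfunE /= /tlift_fun.
rewrite -[RHS]/(fL w v) {2}(coord_vbasisE v) linear_sum.
apply: eq_bigr => i _; rewrite linearZ /= -[f _ w]/(fR _ w).
rewrite {2}(coord_vbasisE w) linear_sum scaler_sumr.
by apply: eq_bigr => j _; rewrite linearZ /= scalerA mxE.
Qed.

Lemma tensor_ind (P : tensor V W -> Prop) :
    (forall v w, P (v *t w)) -> (forall s t, P s -> P t -> P (s + t)) ->
  forall t, P t.
Proof.
move=> Pt PD t.
have P0 : P 0 by rewrite -(tens0l 0).
have Psum I (r : seq I) (F : I -> tensor V W) :
  (forall i, P (F i)) -> P (\sum_(i <- r) F i).
  by move=> PF; elim/big_rec: _ => // i s _; exact: PD.
suff -> : t = \sum_i \sum_j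
    ((t : 'M_(_, _)) i j *: (vbasis {:V})`_i) *t (vbasis {:W})`_j.
  by apply: (Psum) => i; apply: (Psum) => j.
apply/matrixP => i j; rewrite summxE (bigD1 i) //= summxE (bigD1 j) //=.
rewrite !big1 ?addr0 => [|i' ni|j' nj].
- by rewrite mxE linearZ /= !coord_free ?(basis_free (vbasisP _)) ?eqxx ?mulr1.
- rewrite summxE big1 // => j' _; rewrite mxE linearZ /=.
  by rewrite coord_free ?(basis_free (vbasisP _)) // (negPf ni) mulr0 mul0r.
rewrite mxE [X in _ * X]coord_free ?(basis_free (vbasisP _)) //.
by rewrite (negPf nj) mulr0.
Qed.

Lemma tensor_hom_ext (f g : 'Hom(tensor V W, U)) :
  (forall v w, f (v *t w) = g (v *t w)) -> f = g.
Proof.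
move=> fg; apply/lfunP; elim/tensor_ind=> // s t fs ft.
by rewrite !linearD /= fs ft.
Qed.

End Tensor.

Section TensorMaps.
Variable K : fieldType.
Implicit Types V W U : vectType K.

Definition tmap V V' W W' (f : 'Hom(V, V')) (g : 'Hom(W, W')) :
    'Hom(tensor V W, tensor V' W') :=
  tlift (fun v w => f v *t g w).

Definition tassoc V W U :
    'Hom(tensor (tensor V W) U, tensor V (tensor W U)) :=
  tlift (fun t u => tlift (fun v w => v *t (w *t u)) t).

Definition dual V : Type := 'Hom(V, K^o).
HB.instance Definition _ V := Vector.copy (dual V) 'Hom(V, K^o).

(** [f (x) id] and [id (x) f] for a linear form [f], followed by the
    identifications [k (x) W = W] and [V (x) k = V]. *)
Definition tforml V W (f : dual V) : 'Hom(tensor V W, W) :=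
  tlift (fun v w => f v *: w).
Definition tformr V W (f : dual W) : 'Hom(tensor V W, V) :=
  tlift (fun v w => f w *: v).

(** The pairing of [f (x) a] with [v (x) w] is [f v * a w]. *)
Definition tpair V W (t : tensor (dual V) (dual W)) (v : V) (w : W) :
    K^o :=
  tlift (fun (f : dual V) (a : dual W) => (f v * a w : K^o)) t.

(** For bilinear [f] and [g], the bilinear map sending
    [(v (x) v', w (x) w')] to [f v w (x) g v' w']. *)
Definition tmap2 V V' W W' U U' (f : V -> W -> U) (g : V' -> W' -> U')
    (s : tensor V V') (t : tensor W W') : tensor U U' :=
  tlift (fun v v' => tlift (fun w w' => f v w *t g v' w') t) s.

Lemma bilin_tens2 V V' W W' (f : 'Hom(V, V')) (g : 'Hom(W, W')) :
  bilin (fun v w => f v *t g w).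
Proof.
by split=> [w a v v'|v a w w']; rewrite linearP ?(tensDl, tensDr, tensZl, tensZr).
Qed.

Lemma tmapE V V' W W' (f : 'Hom(V, V')) (g : 'Hom(W, W')) v w :
  tmap f g (v *t w) = f v *t g w.
Proof. exact/tliftE/bilin_tens2. Qed.

Lemma tformlE V W (f : dual V) v (w : W) :
  tforml W f (v *t w) = f v *: w.
Proof.
apply: tliftE; split=> [w' a v' v''|v' a w' w''].
  by rewrite linearP scalerDl scalerA.
by rewrite scalerDr !scalerA mulrC.
Qed.

Lemma tformrE V W (f : dual W) (v : V) w :
  tformr V f (v *t w) = f w *: v.
Proof.
apply: tliftE; split=> [w' a v' v''|v' a w' w''].
  by rewrite scalerDr !scalerA mulrC.
by rewrite linearP scalerDl scalerA.
Qed.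

Lemma tpairE V W (f : dual V) (a : dual W) v w :
  tpair (f *t a) v w = f v * a w.
Proof.
apply: (tliftE (f := fun (f : dual V) (a : dual W) =>
  (f v * a w : K^o))).
split=> [a' c f1 f2|f' c a1 a2]; rewrite lfunE /= lfunE /=.
  by rewrite mulrDl -[RHS]/(_ * (_ * _) + _) mulrA.
by rewrite mulrDr -[RHS]/(_ * (_ * _) + _) mulrCA.
Qed.

Lemma tlift_ext V W U (f g : V -> W -> U) t :
  (forall v w, f v w = g v w) -> tlift f t = tlift g t.
Proof.
move=> fg; rewrite !lfunE /= /tlift_fun.
by do 2!apply: eq_bigr => ? _; rewrite fg.
Qed.

Lemma tlift_linear V W U (f g : V -> W -> U) a t :
  tlift (fun v w => a *: f v w + g v w) t = a *: tlift f t + tlift g t.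
Proof.
rewrite !lfunE /= /tlift_fun scaler_sumr -big_split; apply: eq_bigr => i _.
rewrite scaler_sumr -big_split; apply: eq_bigr => j _ /=.
by rewrite scalerDr !scalerA mulrC.
Qed.

Lemma tassocE V W U (v : V) (w : W) (u : U) :
  tassoc V W U ((v *t w) *t u) = v *t (w *t u).
Proof.
have bl u' : bilin (fun (v : V) (w : W) => v *t (w *t u')).
  by split=> [? ? ? ?|? ? ? ?]; rewrite ?(tensDl, tensDr, tensZl, tensZr).
rewrite tliftE ?tliftE //; split=> [u' a s t|t a u1 u2]; first exact: linearP.
rewrite -tlift_linear; apply: tlift_ext => v' w'.
by rewrite !(tensDl, tensDr, tensZl, tensZr).
Qed.

Section Tmap2.
Variables (V V' W W' U U' : vectType K).
Variables (f : V -> W -> U) (g : V' -> W' -> U').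
Hypotheses (fB : bilin f) (gB : bilin g).

Let bilin_in v v' : bilin (fun w w' => f v w *t g v' w').
Proof.
by split=> [x a y z|x a y z]; rewrite ?fB.2 ?gB.2 ?(tensDl, tensDr, tensZl, tensZr).
Qed.

Let bilin_out t : bilin (fun v v' => tlift (fun w w' => f v w *t g v' w') t).
Proof.
split=> [x a y z|x a y z]; rewrite -tlift_linear;
  apply: tlift_ext => w w'.
  by rewrite fB.1 tensDl tensZl.
by rewrite gB.1 tensDr tensZr.
Qed.

Lemma tmap2E v v' w w' :
  tmap2 f g (v *t v') (w *t w') = f v w *t g v' w'.
Proof. by rewrite /tmap2 tliftE // tliftE. Qed.

Lemma tmap2_bilin : bilin (tmap2 f g).
Proof.
split=> [t|s]; first exact: linearP.
elim/tensor_ind: s => [v v'|s1 s2 IH1 IH2] a x y.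
  by rewrite /tmap2 !tliftE // linearP.
move: (IH1 a x y) (IH2 a x y); rewrite /tmap2 !linearD /= => -> ->.
by rewrite addrACA.
Qed.

Lemma tmap2Dl s s' t : tmap2 f g (s + s') t = tmap2 f g s t + tmap2 f g s' t.
Proof. by have := tmap2_bilin.1 t 1 s s'; rewrite !scale1r. Qed.
Lemma tmap2Dr s t t' : tmap2 f g s (t + t') = tmap2 f g s t + tmap2 f g s t'.
Proof. by have := tmap2_bilin.2 s 1 t t'; rewrite !scale1r. Qed.
Lemma tmap2Zl a s t : tmap2 f g (a *: s) t = a *: tmap2 f g s t.
Proof.
have := tmap2_bilin.1 t a s 0; rewrite addr0 => ->.
by rewrite {2}/tmap2 linear0 addr0.
Qed.
Lemma tmap2Zr a s t : tmap2 f g s (a *: t) = a *: tmap2 f g s t.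
Proof.
have H0 : tmap2 f g s 0 = 0.
  by have := tmap2_bilin.2 s (-1) 0 0; rewrite addr0 scaler0 scaleN1r addNr.
by have := tmap2_bilin.2 s a t 0; rewrite !addr0 H0 addr0.
Qed.
End Tmap2.

End TensorMaps.

Lemma mul_bilin (K : fieldType) (A : falgType K) :
  bilin (fun a b : A => a * b).
Proof.
by split=> [x a y z|x a y z]; rewrite ?mulrDl ?mulrDr -?scalerAl -?scalerAr.
Qed.
#[global] Hint Resolve mul_bilin : core.

Section TensorAlgebra.
Variables (K : fieldType) (A B : falgType K).
Implicit Types s t u : tensor A B.

Definition tmul s t : tensor A B := tmap2 *%R *%R s t.

Lemma tmul_pure (a a' : A) (b b' : B) :
  tmul (a *t b) (a' *t b') = (a * a') *t (b * b').
Proof. exact: tmap2E. Qed.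

Lemma tmulDl : left_distributive tmul +%R.
Proof. by move=> *; apply: tmap2Dl. Qed.
Lemma tmulDr : right_distributive tmul +%R.
Proof. by move=> *; apply: tmap2Dr. Qed.

Lemma tmulA : associative tmul.
Proof.
elim/tensor_ind=> [a b|s s' IHs IHs'] t u; last by rewrite !tmulDl IHs IHs'.
elim/tensor_ind: t => [a' b'|t t' IHt IHt']; last first.
  by rewrite !(tmulDr, tmulDl) IHt IHt'.
elim/tensor_ind: u => [a'' b''|u u' IHu IHu']; last first.
  by rewrite !tmulDr IHu IHu'.
by rewrite !tmul_pure !mulrA.
Qed.

Lemma tmul1 : left_id ((1 : A) *t (1 : B)) tmul.
Proof.
by elim/tensor_ind=> [a b|s t IHs IHt]; rewrite ?tmulDr ?IHs ?IHt // tmul_pure !mul1r.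
Qed.
Lemma tmulr1 : right_id ((1 : A) *t (1 : B)) tmul.
Proof.
by elim/tensor_ind=> [a b|s t IHs IHt]; rewrite ?tmulDl ?IHs ?IHt // tmul_pure !mulr1.
Qed.

Lemma coord_neq0 (V : vectType K) (v : V) :
  v != 0 -> exists i, coord (vbasis {:V}) i v != 0.
Proof.
move=> nz; apply/existsP; apply: contraNT nz; rewrite negb_exists => /forallP c0.
rewrite (coord_vbasisE v) big1 // => i _.
by have /negPn/eqP -> := c0 i; rewrite scale0r.
Qed.

Lemma tens1_neq0 : (1 : A) *t (1 : B) != 0.
Proof.
have [i ni] := coord_neq0 (oner_neq0 A).
have [j nj] := coord_neq0 (oner_neq0 B).
apply/eqP => /matrixP/(_ i j); rewrite !mxE => /eqP.
by rewrite mulf_eq0 (negPf ni) (negPf nj).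
Qed.

HB.instance Definition _ := GRing.Zmodule_isNzRing.Build (tensor A B)
  tmulA tmul1 tmulr1 tmulDl tmulDr tens1_neq0.

Lemma tensMM (a a' : A) (b b' : B) :
  (a *t b) * (a' *t b') = (a * a') *t (b * b').
Proof. exact: tmul_pure. Qed.

Fact tens_scalerAl (c : K) s t : c *: (s * t) = (c *: s) * t.
Proof. by symmetry; apply: tmap2Zl. Qed.
Fact tens_scalerAr (c : K) s t : c *: (s * t) = s * (c *: t).
Proof. by symmetry; apply: tmap2Zr. Qed.

HB.instance Definition _ :=
  GRing.Lmodule_isLalgebra.Build K (tensor A B) tens_scalerAl.
HB.instance Definition _ :=
  GRing.Lalgebra_isAlgebra.Build K (tensor A B) tens_scalerAr.
HB.instance Definition _ := Algebra_isFalgebra.Build K (tensor A B).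
End TensorAlgebra.

HB.mixin Record isCoalgebra (K : fieldType) C of Vector K C := {
  comul : 'Hom(C, tensor C C);
  counit : dual C;
  comulA : forall c : C,
    tassoc C C C (tmap comul \1%VF (comul c)) = tmap \1%VF comul (comul c);
  counitl : forall c : C, tforml C counit (comul c) = c;
  counitr : forall c : C, tformr C counit (comul c) = c
}.

#[short(type="coalgType")]
HB.structure Definition Coalgebra (K : fieldType) :=
  { C of isCoalgebra K C & Vector K C }.

HB.mixin Record isHopf (K : fieldType) H of Falgebra K H & Coalgebra K H := {
  comul1 : comul (1 : H) = (1 : H) *t (1 : H);
  comulM : forall x y : H, comul (x * y) = comul x * comul y;
  counit1 : counit (1 : H) = (1 : K);
  counitM : forall x y : H, counit (x * y) = (counit x * counit y : K);
  antipode : 'End(H);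
  antipodel : forall x : H,
    tlift (fun a b : H => antipode a * b) (comul x) = (counit x : K)%:A;
  antipoder : forall x : H,
    tlift (fun a b : H => a * antipode b) (comul x) = (counit x : K)%:A
}.

#[short(type="hopfType")]
HB.structure Definition Hopf (K : fieldType) :=
  { H of isHopf K H & Falgebra K H & Coalgebra K H }.

(** The [H]-action is bilinear by its type.  A separate mixin is used rather than
    [lmodType H] because [C] already carries its scalar multiplication by [K]. *)
HB.mixin Record isModCoalgebra (K : fieldType) (H : hopfType K) C
    of Coalgebra K C := {
  act : 'Hom(H, 'End(C));
  act1 : forall c : C, act 1 c = c;
  actM : forall (g h : H) (c : C), act (g * h) c = act g (act h c);
  comul_act : forall (h : H) (c : C),
    comul (act h c) =
      tmap2 (fun g d => act g d) (fun g d => act g d) (comul h) (comul c);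
  counit_act : forall (h : H) (c : C),
    counit (act h c) = (counit h * counit c : K)
}.

#[short(type="modCoalgType")]
HB.structure Definition ModCoalgebra (K : fieldType) (H : hopfType K) :=
  { C of isModCoalgebra K H C & Coalgebra K C }.

Definition modcoalg_iso (K : fieldType) (H : hopfType K)
    (C D : modCoalgType H) : Prop :=
  exists f : 'Hom(C, D),
    [/\ bijective f,
        forall (h : H) (c : C), f (act h c) = act h (f c),
        forall c : C, tmap f f (comul c) = comul (f c)
      & forall c : C, counit (f c) = counit c :> K].

Definition regular_iso (K : fieldType) (H : hopfType K) (C : modCoalgType H)
    (i : 'Hom(C, H)) : Prop :=
  bijective i /\ forall (h : H) (c : C), i (act h c) = h * i c.

Section Twists.
Variables (K : fieldType) (H : hopfType K).
Implicit Types J : tensor H H.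

(** The last two conditions are the normalization
    [(eps (x) id)(J) = (id (x) eps)(J) = 1]. *)
Definition is_twist J : Prop :=
  [/\ J \is a GRing.unit,
      tassoc H H H (tmap comul \1%VF J * (J *t (1 : H))) =
        tmap \1%VF comul J * ((1 : H) *t J),
      tforml H counit J = 1
    & tformr H counit J = 1].

Record twist : Type := Twist {
  twist_val : tensor H H;
  twistP : is_twist twist_val
}.

Definition gauge_equiv (J J' : twist) : Prop :=
  exists x : H,
    [/\ x \is a GRing.unit, counit x = (1 : K)
      & twist_val J' = comul x * twist_val J * (x^-1 *t x^-1)].

(** The alias [twisted J] of [H] carries the structure of [H^(J)]. *)
Definition twisted (J : twist) : Type := H.
HB.instance Definition _ (J : twist) := Vector.copy (twisted J) H.
End Twists.

Section TwistedCoalgebra.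
Variables (K : fieldType) (H : hopfType K).

Lemma tmap_mul (A B A' B' : falgType K) (f : 'Hom(A, A')) (g : 'Hom(B, B')) :
    (forall x y, f (x * y) = f x * f y) -> (forall x y, g (x * y) = g x * g y) ->
  forall s t, tmap f g (s * t) = tmap f g s * tmap f g t.
Proof.
move=> fM gM; elim/tensor_ind=> [a b|s s' IHs IHs'] t; last first.
  by rewrite mulrDl !linearD /= IHs IHs' mulrDl.
elim/tensor_ind: t => [a' b'|t t' IHt IHt']; last first.
  by rewrite mulrDr !linearD /= IHt IHt' mulrDr.
by rewrite tensMM !tmapE fM gM tensMM.
Qed.

Lemma tassocM (A B C : falgType K) s t :
  tassoc A B C (s * t) = tassoc A B C s * tassoc A B C t.
Proof.
elim/tensor_ind: s t => [x c|s s' IHs IHs'] t; last first.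
  by rewrite mulrDl !linearD /= IHs IHs' mulrDl.
elim/tensor_ind: t => [y c'|t t' IHt IHt']; last first.
  by rewrite mulrDr !linearD /= IHt IHt' mulrDr.
rewrite tensMM; elim/tensor_ind: x => [a b|x x' IHx IHx']; last first.
  by rewrite mulrDl !tensDl !linearD /= IHx IHx' mulrDl.
elim/tensor_ind: y => [a' b'|y y' IHy IHy']; last first.
  by rewrite mulrDr !tensDl !linearD /= IHy IHy' mulrDr.
by rewrite tensMM !tassocE !tensMM.
Qed.

Lemma tforml_counitM s t :
  tforml H counit (s * t) = tforml H counit s * tforml H (counit : dual H) t.
Proof.
elim/tensor_ind: s t => [a b|s s' IHs IHs'] t; last first.
  by rewrite mulrDl !linearD /= IHs IHs' mulrDl.
elim/tensor_ind: t => [a' b'|t t' IHt IHt']; last first.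
  by rewrite mulrDr !linearD /= IHt IHt' mulrDr.
by rewrite tensMM !tformlE counitM -scalerAl -scalerAr scalerA.
Qed.

Lemma tformr_counitM s t :
  tformr H counit (s * t) = tformr H counit s * tformr H (counit : dual H) t.
Proof.
elim/tensor_ind: s t => [a b|s s' IHs IHs'] t; last first.
  by rewrite mulrDl !linearD /= IHs IHs' mulrDl.
elim/tensor_ind: t => [a' b'|t t' IHt IHt']; last first.
  by rewrite mulrDr !linearD /= IHt IHt' mulrDr.
by rewrite tensMM !tformrE counitM -scalerAl -scalerAr scalerA.
Qed.

Variable J : twist H.

Definition twisted_comul : 'Hom(H, tensor H H) :=
  (amulr (twist_val J) \o comul)%VF.

Lemma twisted_comulE c : twisted_comul c = comul c * twist_val J.
Proof. by rewrite comp_lfunE lfunE. Qed.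

Lemma tmap_twisted_l t :
  tmap twisted_comul \1%VF t = tmap comul \1%VF t * (twist_val J *t (1 : H)).
Proof.
elim/tensor_ind: t => [a b|s t IHs IHt]; last by rewrite !linearD /= IHs IHt mulrDl.
by rewrite !tmapE tensMM mulr1 twisted_comulE.
Qed.

Lemma tmap_twisted_r t :
  tmap \1%VF twisted_comul t = tmap \1%VF comul t * ((1 : H) *t twist_val J).
Proof.
elim/tensor_ind: t => [a b|s t IHs IHt]; last by rewrite !linearD /= IHs IHt mulrDl.
by rewrite !tmapE tensMM mulr1 twisted_comulE.
Qed.

Fact twisted_comulA c :
  tassoc H H H (tmap twisted_comul \1%VF (twisted_comul c)) =
    tmap \1%VF twisted_comul (twisted_comul c).
Proof.
have [_ Jc _ _] := twistP J.
have id1 (x y : H) : \1%VF (x * y) = \1%VF x * \1%VF y :> H by rewrite !lfunE.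
rewrite tmap_twisted_l tmap_twisted_r twisted_comulE.
rewrite !(tmap_mul (@comulM _ _) id1, tmap_mul id1 (@comulM _ _)).
by rewrite -!mulrA tassocM Jc comulA.
Qed.

Fact twisted_counitl c : tforml H counit (twisted_comul c) = c.
Proof.
have [_ _ Jl _] := twistP J.
by rewrite twisted_comulE tforml_counitM Jl mulr1 counitl.
Qed.

Fact twisted_counitr c : tformr H counit (twisted_comul c) = c.
Proof.
have [_ _ _ Jr] := twistP J.
by rewrite twisted_comulE tformr_counitM Jr mulr1 counitr.
Qed.

HB.instance Definition _ := isCoalgebra.Build K (twisted J)
  twisted_comulA twisted_counitl twisted_counitr.

Definition regular_act : 'Hom(H, 'End(H)) := linfun (@amull K H).

Lemma regular_actE h c : regular_act h c = h * c.
Proof. by rewrite lfunE /= lfunE. Qed.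

Fact twisted_comul_act (h c : H) : twisted_comul (regular_act h c) =
  tmap2 (fun g d => regular_act g d) (fun g d => regular_act g d)
    (comul h) (twisted_comul c).
Proof.
rewrite regular_actE !twisted_comulE comulM -mulrA.
rewrite -[LHS]/(tmap2 *%R *%R (comul h) (comul c * twist_val J)).
apply: tlift_ext => g g'; apply: tlift_ext => d d'.
by rewrite !regular_actE.
Qed.

Fact regular_act1 c : regular_act 1 c = c.
Proof. by rewrite regular_actE mul1r. Qed.
Fact regular_actM g h c : regular_act (g * h) c = regular_act g (regular_act h c).
Proof. by rewrite !regular_actE mulrA. Qed.
Fact twisted_counit_act (h c : H) :
  counit (regular_act h c) = (counit h * counit c : K).
Proof. by rewrite regular_actE counitM. Qed.

HB.instance Definition _ := isModCoalgebra.Build K H (twisted J)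
  regular_act1 regular_actM twisted_comul_act twisted_counit_act.
End TwistedCoalgebra.

Section TwistedSpec.
Variables (K : fieldType) (H : hopfType K) (J : twist H).

Lemma comul_twistedE (c : H) :
  comul (c : twisted J) = comul c * twist_val J :> tensor H H.
Proof. exact: twisted_comulE. Qed.
Lemma counit_twistedE (c : H) : counit (c : twisted J) = counit c.
Proof. by []. Qed.
Lemma act_twistedE (h c : H) : act h (c : twisted J) = h * c :> H.
Proof. exact: regular_actE. Qed.
End TwistedSpec.

Definition pure_form (K : fieldType) (V W : vectType K) (a : dual V)
    (b : dual W) : dual (tensor V W) :=
  tlift (fun v w => (a v * b w : K^o)).

Lemma pure_formE (K : fieldType) (V W : vectType K) (a : dual V) (b : dual W)
    v w :
  pure_form a b (v *t w) = a v * b w.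
Proof.
apply: (tliftE (f := fun v w => (a v * b w : K^o))).
split=> [x k y z|x k y z]; rewrite linearP /=.
  by rewrite mulrDl -[RHS]/(_ * (_ * _) + _) mulrA.
by rewrite mulrDr -[RHS]/(_ * (_ * _) + _) mulrCA.
Qed.

Section PureForm.
Variables (K : fieldType) (V W U V' W' : vectType K).

Lemma pure_formA (a : dual V) (b : dual W) (d : dual U) t :
  pure_form (pure_form a b) d t = pure_form a (pure_form b d) (tassoc V W U t).
Proof.
elim/tensor_ind: t => [s u|s t IHs IHt]; last by rewrite !linearD /= IHs IHt.
elim/tensor_ind: s => [v w|s t IHs IHt].
  by rewrite tassocE !pure_formE mulrA.
by rewrite !tensDl !linearD /= IHs IHt.
Qed.

Lemma pure_form_comp (a : dual V) (b : dual W) (f : 'Hom(V', V))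
    (g : 'Hom(W', W)) t :
  pure_form (a \o f)%VF (b \o g)%VF t = pure_form a b (tmap f g t).
Proof.
elim/tensor_ind: t => [v w|s t IHs IHt]; last by rewrite !linearD /= IHs IHt.
by rewrite tmapE !pure_formE !comp_lfunE.
Qed.
End PureForm.

Section DualAlgebra.
Variables (K : fieldType) (C : coalgType K).
Implicit Types a b : dual C.

Definition dual_mul a b : dual C := (pure_form a b \o comul)%VF.

Lemma dual_mulE a b c : dual_mul a b c = pure_form a b (comul c).
Proof. exact: comp_lfunE. Qed.

Fact dual_mulA : associative dual_mul.
Proof.
move=> a b d; apply/lfunP => c; rewrite !dual_mulE.
rewrite -[a in LHS]comp_lfun1r -[d in RHS]comp_lfun1r !pure_form_comp.
by rewrite pure_formA comulA.
Qed.

Fact dual_mul1 : left_id counit dual_mul.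
Proof.
move=> a; apply/lfunP => c; rewrite dual_mulE -{2}(counitl c).
elim/tensor_ind: (comul c) => [x y|s t IHs IHt]; last by rewrite !linearD /= IHs IHt.
by rewrite pure_formE tformlE linearZ.
Qed.

Fact dual_mulr1 : right_id counit dual_mul.
Proof.
move=> a; apply/lfunP => c; rewrite dual_mulE -{2}(counitr c).
elim/tensor_ind: (comul c) => [x y|s t IHs IHt]; last by rewrite !linearD /= IHs IHt.
by rewrite pure_formE tformrE linearZ /= mulrC.
Qed.

Fact dual_mul_bilin : bilin dual_mul.
Proof.
have ZE (k x : K) : k *: (x : K^o) = k * x by [].
split=> [b k x y|x k y z]; apply/lfunP => c;
  rewrite !(dual_mulE, add_lfunE, scale_lfunE) -tlift_linear;
  apply: tlift_ext => v w; rewrite !(add_lfunE, scale_lfunE) !ZE.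
  by rewrite mulrDl mulrA.
by rewrite mulrDr mulrCA.
Qed.

Fact dual_mulDl : left_distributive dual_mul +%R.
Proof. by move=> a b d; have := dual_mul_bilin.1 d 1 a b; rewrite !scale1r. Qed.
Fact dual_mulDr : right_distributive dual_mul +%R.
Proof. by move=> a b d; have := dual_mul_bilin.2 a 1 b d; rewrite !scale1r. Qed.

(** [C^*] is only a [pzRingType], since [C = 0] is allowed. *)
HB.instance Definition _ := GRing.Zmodule_isPzRing.Build (dual C)
  dual_mulA dual_mul1 dual_mulr1 dual_mulDl dual_mulDr.
End DualAlgebra.

Section Galois.
Variables (K : fieldType) (H : hopfType K) (C : modCoalgType H).
Implicit Types a b : dual C.

(** In terms of a basis [(e_i)] of [H] with dual basis [(e^i)], the coaction is
    [a |-> \sum_i e^i (x) a(e_i . _)]; see [coactionE] and [coaction_unique]. *)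
Definition coaction a : tensor (dual H) (dual C) :=
  \sum_i (linfun (coord (vbasis {:H}) i : H -> K^o) : dual H) *t
           ((a \o act (vbasis {:H})`_i)%VF : dual C).

Lemma coactionE a (h : H) (c : C) : tpair (coaction a) h c = a (act h c).
Proof.
rewrite /tpair linear_sum /= {2}(coord_vbasisE h) !linear_sum sum_lfunE linear_sum.
apply: eq_bigr => i _; rewrite -/(tpair _ h c) tpairE lfunE comp_lfunE /=.
by rewrite linearZ scale_lfunE linearZ.
Qed.

Lemma coaction_unique a t :
  (forall (h : H) (c : C), tpair t h c = a (act h c)) -> t = coaction a.
Proof.
pose ev t (h : H) : dual C := tlift (fun (f : dual H) (b : dual C) => f h *: b) t.
have evE (f : dual H) (b : dual C) h : ev (f *t b) h = f h *: b.
  rewrite /ev tliftE //; split=> [d k x y|d k x y].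
    by rewrite add_lfunE scale_lfunE scalerDl scalerA.
  by rewrite scalerDr !scalerA mulrC.
have tE (s : tensor (dual H) (dual C)) :
    s = \sum_i (linfun (coord (vbasis {:H}) i : H -> K^o) : dual H) *t ev s (vbasis {:H})`_i.
  elim/tensor_ind: s => [f b|s s' IHs IHs'].
    under eq_bigr => i _ do rewrite evE tensZr -tensZl.
    rewrite -(linear_sum (HB.pack_for {linear dual H -> _} (fun f => f *t b)
      (GRing.isLinear.Build _ _ _ _ (fun f => f *t b) ((tens_bilin _ _).1 b)))) /=.
    congr (_ *t b); apply/lfunP => h; rewrite {1}(coord_vbasisE h) linear_sum.
    rewrite sum_lfunE; apply: eq_bigr => i _.
    by rewrite linearZ scale_lfunE lfunE /= [LHS]mulrC.
  rewrite {1}IHs {1}IHs' -big_split; apply: eq_bigr => i _.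
  by rewrite /= -tensDr /ev linearD.
move=> tP; rewrite [t]tE; apply: eq_bigr => i _; congr (_ *t _).
apply/lfunP => c; rewrite comp_lfunE -tP; move: (_`_i) => h.
elim/tensor_ind: {tP} t => [f b|s s' IHs IHs'].
  by rewrite evE tpairE scale_lfunE.
by rewrite /ev /tpair !linearD /= add_lfunE -/(ev s h) -/(ev s' h) IHs IHs'.
Qed.

Lemma coaction_linear : linear coaction.
Proof.
move=> k a b; rewrite /coaction scaler_sumr -big_split; apply: eq_bigr => i _.
by rewrite /= comp_lfunDl -comp_lfunZl tensDr tensZr.
Qed.

Definition dual_tmul (s t : tensor (dual H) (dual C)) : tensor (dual H) (dual C) :=
  tmap2 (fun f g : dual H => f * g) (fun a b : dual C => a * b) s t.

Definition galois_map :
    'Hom(tensor (dual C) (dual C), tensor (dual H) (dual C)) :=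
  tlift (fun a b => dual_tmul ((1 : dual H) *t a) (coaction b)).

Lemma galois_mapE a b :
  galois_map (a *t b) = dual_tmul ((1 : dual H) *t a) (coaction b).
Proof.
rewrite /galois_map tliftE //; split=> [x k y z|x k y z].
  rewrite (tens_bilin _ _).2 [LHS](tmap2_bilin _ _).1 //; exact: dual_mul_bilin.
rewrite coaction_linear [LHS](tmap2_bilin _ _).2 //; exact: dual_mul_bilin.
Qed.

(** [<[1]>] is the line [k 1] in [C^*]. *)
Definition is_galois : Prop :=
  (forall a, coaction a = (1 : dual H) *t a <-> a \in <[1 : dual C]>%VS)
  /\ bijective galois_map.
End Galois.

Definition regular_galois (K : fieldType) (H : hopfType K)
    (C : modCoalgType H) : Prop :=
  (exists i : 'Hom(C, H), regular_iso i) /\ is_galois C.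

(** [J] is the normalized rescaling of [(i (x) i) Delta_C (i^-1 1)]; elements of
    [twist H] being normalized, this determines [s].  For a bijective [i],
    [i^-1%VF] is its inverse. *)
Definition twist_from (K : fieldType) (H : hopfType K) (C : modCoalgType H)
    (i : 'Hom(C, H)) (J : twist H) : Prop :=
  exists2 s : K, s != 0 &
    twist_val J = s *: tmap i i (comul ((i^-1)%VF (1 : H))).

Section Equivalences.
Variables (K : fieldType) (H : hopfType K).

Lemma gauge_equiv_refl (J : twist H) : gauge_equiv J J.
Proof.
exists 1; split; [exact: unitr1 | exact: counit1 |].
by rewrite comul1 invr1 -[_ *t _]/(1 : tensor H H) mul1r mulr1.
Qed.

Lemma gauge_equiv_sym (J J' : twist H) : gauge_equiv J J' -> gauge_equiv J' J.
Proof.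
move=> [x [xU x1 Jx]]; exists x^-1; split; first by rewrite unitrV.
  have : counit (x^-1 * x) = counit (1 : H) by rewrite mulVr.
  by rewrite counitM x1 counit1 mulr1.
rewrite Jx invrK !mulrA -comulM mulVr // comul1 -[_ *t _]/(1 : tensor H H) mul1r.
by rewrite -mulrA tensMM mulVr // -[_ *t _]/(1 : tensor H H) mulr1.
Qed.

Lemma gauge_equiv_trans (J J' J'' : twist H) :
  gauge_equiv J J' -> gauge_equiv J' J'' -> gauge_equiv J J''.
Proof.
move=> [x [xU x1 Jx]] [y [yU y1 Jy]]; exists (y * x); split.
- by rewrite unitrMl.
- by rewrite counitM x1 y1 mulr1.
by rewrite Jy Jx comulM invrM // !mulrA -[LHS]mulrA tensMM.
Qed.

Implicit Types C D E : modCoalgType H.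

Lemma modcoalg_iso_refl C : modcoalg_iso C C.
Proof.
exists \1%VF; split=> [|h c|c|c]; rewrite ?id_lfunE //.
  by exists id => c; rewrite id_lfunE.
elim/tensor_ind: (comul c) => [v w|s t IHs IHt]; last by rewrite linearD /= IHs IHt.
by rewrite tmapE !id_lfunE.
Qed.

Lemma modcoalg_iso_sym C D : modcoalg_iso C D -> modcoalg_iso D C.
Proof.
move=> [f [fB fa fD fe]].
have k0 : lker f == 0%VS by apply/lker0P; exact: bij_inj.
have fK : cancel f f^-1%VF by exact: lker0_lfunK.
have gK : cancel f^-1%VF f.
  by move=> d; have [g gf fg] := fB; rewrite -(fg d) fK.
exists f^-1%VF; split=> [|h d|d|d].
- by exists f.
- by apply: (can_inj fK); rewrite fa !gK.
- rewrite -{1}(gK d) -fD; move: (comul _) => t.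
  elim/tensor_ind: t => [v w|s t IHs IHt]; last by rewrite !linearD /= IHs IHt.
  by rewrite !tmapE !fK.
by rewrite -fe gK.
Qed.

Lemma modcoalg_iso_trans C D E :
  modcoalg_iso C D -> modcoalg_iso D E -> modcoalg_iso C E.
Proof.
move=> [f [fB fa fD fe]] [g [gB ga gD ge]]; exists (g \o f)%VF.
split=> [|h c|c|c]; rewrite ?comp_lfunE.
- exact: eq_bij (bij_comp gB fB) _ (fun c => esym (comp_lfunE g f c)).
- by rewrite fa ga.
- rewrite -gD -fD; move: (comul c) => t.
  elim/tensor_ind: t => [v w|s t IHs IHt]; last by rewrite !linearD /= IHs IHt.
  by rewrite !tmapE !comp_lfunE.
by rewrite ge fe.
Qed.

End Equivalences.

(* Main.v *)
Require Import Defs.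
From HB Require Import structures.
From mathcomp Require Import all_boot all_order all_algebra all_field.

Set Implicit Arguments.
Unset Strict Implicit.
Unset Printing Implicit Defensive.

Import GRing.Theory.
Local Open Scope ring_scope.

(** Write [i^-1 1 = u] for a cyclic generator of a regular module coalgebra [C].
    Every [c] in [C] is [h . u], and [Delta_C (h . u) = Delta(h) . Delta_C(u)];
    so [C] is determined by the element [J] corresponding to [Delta_C(u)], and
    coassociativity and counitality of [C], read at [u], are exactly the cocycle
    identity and the normalization of [J].  The scalar by which [J] must be
    rescaled is [eps_C(u)], which cannot vanish because [eps_C] is a counit;
    replacing [u] by [u / eps_C(u)] normalizes [J] once and for all
    ([regular_frame]).  Module maps [H -> H] are right multiplications by some [x],
    and such a map is an isomorphism [H^(J) -> H^(J')] exactly when [x] is a unit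
    with [J (x (x) x) = Delta(x) J'], that is when [x^-1] is a gauge
    transformation ([gauge_twisted_iso], [twisted_iso_gauge]).

    What remains is that [J] is invertible if and only if [k] in [C^*] is Galois.
    The Galois map is the transpose of [h (x) c |-> c_1 (x) h c_2]; after
    identifying [C] with [H] the latter is the map
    [shear : h (x) c |-> (1 (x) h) Delta(c)] followed by right multiplication
    by [J] ([galois_pairing]).  So everything reduces to the bijectivity of [shear]
    ([shear_bij]), in which [J] has disappeared.

    The shear has the order of factors for which the antipode [S] itself does not
    give the inverse: [S^-1] does.  Hence the need for the theorem of Larson and
    Sweedler that [S] is injective when [H] is finite-dimensional
    ([antipode_inj]).  It is proved here by looking at [H^*] as a Hopf module over
    [H], where [h] acts by [(m . h)(x) = m(x S(h))].  As for any Hopf module,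
    projecting the elements of [H^*] to coinvariants shows that there is a non-zero
    coinvariant, i.e. an integral [lam] with [g * lam = g(1) lam] for all [g]
    ([exists_integral]); and [lam . h = 0] forces [h = 0].  As
    [lam . h] depends on [S(h)] only, [S] is injective.

    Sweedler sums [\sum F(x_1, x_2)] are written [tlift F (comul x)]. *)

(** * Linear algebra *)

Section LinearAlgebra.
Variable K : fieldType.
Implicit Types V W U X Y : vectType K.

Lemma linfunE (V W : vectType K) (f : V -> W) : linear f -> linfun f =1 f.
Proof.
move=> fl v.
by rewrite (lfunE (HB.pack_for {linear V -> W} f (GRing.isLinear.Build K V W _ f fl))).
Qed.

Lemma inj_hom_bij V W (f : 'Hom(V, W)) :
  \dim {:V} = \dim {:W} -> (forall v, f v = 0 -> v = 0) -> bijective f.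
Proof.
move=> eqd f0.
have k0 : lker f == 0%VS.
  by apply/lker0P => x y fxy; apply/subr0_eq/f0; rewrite linearB /= fxy subrr.
have im : limg f = fullv.
  have c0 : (fullv :&: lker f = 0)%VS by rewrite (eqP k0) capv0.
  by apply/eqP; rewrite eqEdim subvf (limg_dim_eq c0) eqd /=.
exists f^-1%VF; first exact: lker0_lfunK.
by move=> w; apply: limg_lfunVK; rewrite im memvf.
Qed.

Lemma inj_amulr_unit (A : falgType K) (u : A) :
  (forall v, v * u = 0 -> v = 0) -> u \is a GRing.unit.
Proof.
move=> u0.
have /bij_inj uI : bijective (amulr u).
  by apply: inj_hom_bij => // v; rewrite lfunE; exact: u0.
have [g _ gK] : bijective (amulr u).
  by apply: inj_hom_bij => // v; rewrite lfunE; exact: u0.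
have gu : g 1 * u = 1 by rewrite -[RHS]gK lfunE.
apply/unitrP; exists (g 1); split=> //; apply: uI.
by rewrite !lfunE /= -mulrA gu mul1r mulr1.
Qed.

Lemma dim_dual V : \dim {:dual V} = \dim {:V}.
Proof. by rewrite !dimvf /= /dim /= muln1. Qed.

Lemma dim_tensor V W : \dim {:tensor V W} = (\dim {:V} * \dim {:W})%N.
Proof. by rewrite dimvf. Qed.

(** The values of forms live in the module [K^o], whose scaling is the product
    of [K] only by conversion; this and [formDr] bridge the two. *)
Lemma formDl (k p q r : K) :
  (k *: (p : K^o) + q : K^o) * r = k *: (p * r : K^o) + (q * r : K^o) :> K^o.
Proof. by rewrite mulrDl -[RHS]/(_ * (_ * _) + _) mulrA. Qed.

Lemma formDr (k p q r : K) :
  r * (k *: (p : K^o) + q : K^o) = k *: (r * p : K^o) + (r * q : K^o) :> K^o.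
Proof. by rewrite mulrDr -[RHS]/(_ * (_ * _) + _) mulrCA. Qed.

Lemma amullE (A : falgType K) (x y : A) : amull x y = x * y.
Proof. by rewrite lfunE. Qed.

Lemma amulrE (A : falgType K) (x y : A) : amulr x y = y * x.
Proof. by rewrite lfunE. Qed.

End LinearAlgebra.

(** * Sweedler sums *)

Section SweedlerSums.
Variable K : fieldType.
Implicit Types V W U X Y : vectType K.

(** [tlift f] is a finite sum of values of [f] for any function [f], so a linear
    map commutes with it without bilinearity of [f]. *)
Lemma linear_tlift V W U U' (g : {linear U -> U'}) (f : V -> W -> U) t :
  g (tlift f t) = tlift (fun v w => g (f v w)) t.
Proof.
rewrite !lfunE /= /tlift_fun linear_sum; apply: eq_bigr => i _.
by rewrite linear_sum; apply: eq_bigr => j _; rewrite linearZ.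
Qed.

Lemma tlift_sum V W U I (r : seq I) (f : I -> V -> W -> U) t :
  tlift (fun v w => \sum_(i <- r) f i v w) t = \sum_(i <- r) tlift (f i) t.
Proof.
rewrite lfunE /= /tlift_fun.
under [RHS]eq_bigr => i _ do rewrite lfunE /= /tlift_fun.
rewrite [RHS]exchange_big; apply: eq_bigr => a _ /=.
rewrite [RHS]exchange_big; apply: eq_bigr => b _ /=.
by rewrite scaler_sumr.
Qed.

Lemma tlift_exchange V W V' W' U (f : V -> W -> V' -> W' -> U) s t :
  tlift (fun v w => tlift (f v w) t) s =
    tlift (fun v' w' => tlift (fun v w => f v w v' w') s) t.
Proof.
rewrite lfunE /= /tlift_fun.
under eq_bigr => i _.
  under eq_bigr => j _ do rewrite linear_tlift.
  rewrite -tlift_sum; over.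
rewrite -tlift_sum; apply: tlift_ext => v w.
by rewrite lfunE.
Qed.

Lemma tlift_eval (V W X Y : vectType K) (F : V -> W -> 'Hom(X, Y)) t (x : X) :
  tlift F t x = tlift (fun v w => F v w x) t.
Proof.
rewrite !lfunE /= /tlift_fun sum_lfunE; apply: eq_bigr => i _.
by rewrite sum_lfunE; apply: eq_bigr => j _; rewrite scale_lfunE.
Qed.

Lemma tlift_mull (V W : vectType K) (A : falgType K) (x : A) (f : V -> W -> A) t :
  x * tlift f t = tlift (fun v w => x * f v w) t.
Proof.
rewrite -amullE linear_tlift.
by apply: tlift_ext => v w; rewrite /= amullE.
Qed.

Lemma tlift_mulr (V W : vectType K) (A : falgType K) (x : A) (f : V -> W -> A) t :
  tlift f t * x = tlift (fun v w => f v w * x) t.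
Proof.
rewrite -amulrE linear_tlift.
by apply: tlift_ext => v w; rewrite /= amulrE.
Qed.

Lemma tlift_tmap V V' W W' U (f : 'Hom(V, V')) (g : 'Hom(W, W'))
    (F : V' -> W' -> U) t :
  bilin F -> tlift F (tmap f g t) = tlift (fun v w => F (f v) (g w)) t.
Proof.
move=> FB; rewrite linear_tlift; apply: tlift_ext => v w.
exact: tliftE.
Qed.

Lemma tlift_tens (V W : vectType K) (t : tensor V W) : tlift (@tens K V W) t = t.
Proof.
elim/tensor_ind: t => [v w|s t IHs IHt]; last by rewrite linearD /= IHs IHt.
by rewrite tliftE //; apply: tens_bilin.
Qed.

Lemma tlift_mul (A B : falgType K) U (F : A -> B -> U) (s t : tensor A B) :
  bilin F ->
  tlift F (s * t) =
    tlift (fun a b => tlift (fun a' b' => F (a * a') (b * b')) t) s.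
Proof.
move=> FB; rewrite -[s * t]/(tlift _ s) linear_tlift; apply: tlift_ext => a b.
by rewrite linear_tlift; apply: tlift_ext => a' b'; apply: tliftE.
Qed.

Definition tensl (V W : vectType K) (w : W) : 'Hom(V, tensor V W) :=
  linfun (fun v => v *t w).

Lemma tenslE (V W : vectType K) (v : V) (w : W) : tensl V w v = v *t w.
Proof. exact/linfunE/(tens_bilin V W).1. Qed.

Definition tensr (V W : vectType K) (v : V) : 'Hom(W, tensor V W) :=
  linfun (fun w => v *t w).

Lemma tensrE (V W : vectType K) (v : V) (w : W) : tensr W v w = v *t w.
Proof. exact/linfunE/(tens_bilin V W).2. Qed.

Lemma tmapK (V V' W W' : vectType K) (f : 'Hom(V, V')) (f' : 'Hom(V', V))
    (g : 'Hom(W, W')) (g' : 'Hom(W', W)) :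
  cancel f f' -> cancel g g' -> cancel (tmap f g) (tmap f' g').
Proof.
move=> fK gK; elim/tensor_ind=> [v w|s t IHs IHt]; last by rewrite !linearD /= IHs IHt.
by rewrite !tmapE fK gK.
Qed.

Lemma tmapZ (V V' W W' : vectType K) (a b : K) (f : 'Hom(V, V')) (g : 'Hom(W, W')) t :
  tmap (a *: f) (b *: g) t = (a * b) *: tmap f g t.
Proof.
elim/tensor_ind: t => [v w|s t IHs IHt]; last first.
  by rewrite !linearD /= IHs IHt.
by rewrite !tmapE !scale_lfunE tensZl tensZr scalerA.
Qed.

Definition trilin V W X U (G : V -> W -> X -> U) :=
  [/\ forall w x, linear (fun v => G v w x), forall v x, linear (fun w => G v w x)
    & forall v w, linear (G v w)].

Lemma tlift_assoc V W X U (G : V -> W -> X -> U) s :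
  trilin G ->
  tlift (fun v t => tlift (G v) t) (tassoc V W X s) =
    tlift (fun r x => tlift (fun v w => G v w x) r) s.
Proof.
move=> GT; have [G1 G2 G3] := GT.
elim/tensor_ind: s => [r x|s t IHs IHt]; last by rewrite !linearD /= IHs IHt.
rewrite [RHS]tliftE; last first.
  split=> [y a v v'|v a y y']; first by rewrite !linearP.
  by rewrite -tlift_linear; apply: tlift_ext => w z; rewrite G3.
elim/tensor_ind: r => [v w|s t IHs IHt]; last by rewrite tensDl !linearD /= IHs IHt.
rewrite tassocE tliftE; last first.
  split=> [y a z z'|z a y y']; last by rewrite !linearP.
  by rewrite -tlift_linear; apply: tlift_ext => w' x'; rewrite G1.
by rewrite !tliftE.
Qed.

(** Coassociativity in Sweedler form: [\sum G(c_1, c_2, c_3)] has one meaning. *)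
Lemma comul_coassoc (C : coalgType K) U (G : C -> C -> C -> U) (c : C) :
  trilin G ->
  tlift (fun a b => tlift (fun a1 a2 => G a1 a2 b) (comul a)) (comul c) =
    tlift (fun a b => tlift (G a) (comul b)) (comul c).
Proof.
move=> GT; have [G1 G2 G3] := GT.
transitivity (tlift (fun v t => tlift (G v) t)
    (tassoc C C C (tmap comul \1%VF (comul c)))).
  rewrite tlift_assoc // tlift_tmap; last first.
    split=> [y a v v'|v a y y']; first by rewrite !linearP.
    by rewrite -tlift_linear; apply: tlift_ext => w z; rewrite G3.
  by apply: tlift_ext => v w; rewrite id_lfunE.
rewrite comulA tlift_tmap; last first.
  split=> [y a z z'|z a y y']; last by rewrite !linearP.
  by rewrite -tlift_linear; apply: tlift_ext => w' x'; rewrite G1.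
by apply: tlift_ext => v w; rewrite id_lfunE.
Qed.

Lemma comul_counitl (C : coalgType K) U (g : {linear C -> U}) (c : C) :
  tlift (fun a b => counit a *: g b) (comul c) = g c.
Proof.
by rewrite -[in RHS](counitl c) linear_tlift; apply: tlift_ext => a b; rewrite linearZ.
Qed.

Lemma comul_counitr (C : coalgType K) U (g : {linear C -> U}) (c : C) :
  tlift (fun a b => counit b *: g a) (comul c) = g c.
Proof.
by rewrite -[in RHS](counitr c) linear_tlift; apply: tlift_ext => a b; rewrite linearZ.
Qed.

End SweedlerSums.

(** * Coordinate forms and the pairing of tensors *)

Section CoordinateForms.
Variable K : fieldType.
Implicit Types V W : vectType K.

Definition coord_form (V : vectType K) (i : 'I_(\dim {:V})) : dual V :=
  linfun (coord (vbasis {:V}) i : V -> K^o).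

Lemma coord_formE (V : vectType K) i (v : V) :
  coord_form i v = coord (vbasis {:V}) i v.
Proof. by rewrite lfunE. Qed.

Lemma dual_expand (V : vectType K) (f : dual V) :
  f = \sum_(i < \dim {:V}) f (vbasis {:V})`_i *: coord_form i.
Proof.
apply/lfunP => x; rewrite {1}(coord_vbasisE x) linear_sum sum_lfunE.
apply: eq_bigr => i _; rewrite linearZ scale_lfunE coord_formE.
exact: mulrC.
Qed.

Lemma pure_form_coord (V W : vectType K) i j (t : tensor V W) :
  pure_form (coord_form i) (coord_form j) t = t i j.
Proof.
elim/tensor_ind: t => [v w|s t IHs IHt]; last by rewrite linearD /= IHs IHt mxE.
by rewrite pure_formE !coord_formE mxE.
Qed.

Lemma tpair_bilin (V W : vectType K) (t : tensor (dual V) (dual W)) :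
  bilin (tpair t).
Proof.
elim/tensor_ind: t => [f g|s t [IHs1 IHs2] [IHt1 IHt2]].
  split=> [w a u v|v a u w]; rewrite !tpairE linearP /=.
    by rewrite mulrDl -[RHS]/(_ * (_ * _) + _) mulrA.
  by rewrite mulrDr -[RHS]/(_ * (_ * _) + _) mulrCA.
have E v w : tpair (s + t) v w = tpair s v w + tpair t v w by rewrite /tpair linearD.
split=> [w a u v|v a u w]; rewrite !E ?IHs1 ?IHs2 ?IHt1 ?IHt2 scalerDr addrACA //.
Qed.

Lemma tpair_inj (V W : vectType K) (t : tensor (dual V) (dual W)) :
  (forall v w, tpair t v w = 0) -> t = 0.
Proof.
move=> t0.
suff -> : t = \sum_(i < \dim {:V}) \sum_(j < \dim {:W}) 
    tpair t (vbasis {:V})`_i (vbasis {:W})`_j *: (coord_form i *t coord_form j).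
  by rewrite big1 // => i _; rewrite big1 // => j _; rewrite t0 scale0r.
elim/tensor_ind: {t0} t => [f g|s t IHs IHt].
  rewrite {1}(dual_expand f) -tenslE linear_sum; apply: eq_bigr => i _.
  rewrite linearZ /= tenslE {1}(dual_expand g) -tensrE linear_sum scaler_sumr.
  by apply: eq_bigr => j _; rewrite linearZ /= tensrE scalerA tpairE.
rewrite {1}IHs {1}IHt -big_split; apply: eq_bigr => i _.
rewrite -big_split; apply: eq_bigr => j _ /=.
by rewrite -scalerDl /tpair linearD.
Qed.

Lemma tpair_inj_r (V W : vectType K) (s : tensor V W) :
  (forall t : tensor (dual V) (dual W), tlift (tpair t) s = 0) -> s = 0.
Proof.
move=> s0; apply/matrixP => i j; rewrite [RHS]mxE.
rewrite -(s0 (coord_form i *t coord_form j)).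
elim/tensor_ind: {s0} s => [v w|s t IHs IHt]; last by rewrite linearD /= -IHs -IHt mxE.
rewrite tliftE; last exact: tpair_bilin.
by rewrite tpairE !coord_formE mxE.
Qed.

End CoordinateForms.

(** * The antipode reverses products and coproducts *)

Section Antipode.
Variable K : fieldType.

(** If [v] is a left convolution inverse of [u], then [u * g = k] gives
    [g = v * k]: a function is identified by the convolution equation that it
    solves. *)
Lemma convol_cancel (C : coalgType K) (A : falgType K) (u v g : 'Hom(C, A))
    (k : C -> A) :
  (forall c, tlift (fun a b => v a * u b) (comul c) = (counit c : K)%:A) ->
  (forall c, tlift (fun a b => u a * g b) (comul c) = k c) ->
  forall c, g c = tlift (fun a b => v a * k b) (comul c).
Proof.
move=> vu ug c; rewrite -(comul_counitl g).
transitivity (tlift (fun a b => tlift (fun a1 a2 => v a1 * u a2 * g b) (comul a))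
  (comul c)).
  by apply: tlift_ext => a b; rewrite -tlift_mulr vu mulr_algl.
rewrite comul_coassoc; last first.
  by split=> [x y | x y | x y] a z t;
    rewrite linearP ?(mulrDl, mulrDr) -?(scalerAl, scalerAr).
apply: tlift_ext => a b; rewrite -ug tlift_mull.
by apply: tlift_ext => b1 b2; rewrite mulrA.
Qed.

Variable H : hopfType K.
Local Notation S := (@antipode K H).

(** For an algebra map [j], the convolution inverse is [j \o S]. *)
Lemma antipode_convol_cancel (A : falgType K) (j : 'Hom(H, A)) (g : 'Hom(H, A))
    (k : H -> A) :
  j 1 = 1 -> (forall x y, j (x * y) = j x * j y) ->
  (forall x, tlift (fun a b => j a * g b) (comul x) = k x) ->
  forall x, g x = tlift (fun a b => j (S a) * k b) (comul x).
Proof.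
move=> j1 jM jg x.
rewrite (convol_cancel (v := (j \o S)%VF) _ jg).
  by apply: tlift_ext => a b; rewrite comp_lfunE.
move=> c; rewrite -j1 -linearZ -antipodel linear_tlift.
by apply: tlift_ext => a b; rewrite /= comp_lfunE jM.
Qed.

Lemma antipode1 : S 1 = 1.
Proof.
have /(_ 1) := @antipodel K H; rewrite comul1 tliftE.
  by rewrite mulr1 counit1 scale1r.
by split=> [c a u v|c a u v]; rewrite ?linearP ?(mulrDl, mulrDr) -?(scalerAl, scalerAr).
Qed.

(** Both sides are compared one argument at a time.  For fixed [y], the function
    [g(x) = \sum y_1 S(x y_2)] satisfies [\sum x_1 g(x_2) = eps(x) eps(y)], hence
    [g(x) = eps(y) S(x)].  For fixed [x] this says that [y |-> S(x y)] solves
    [\sum y_1 S(x y_2) = eps(y) S(x)], hence equals [S(y) S(x)]. *)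
Lemma antipodeM x y : S (x * y) = S y * S x.
Proof.
have step1 x' y' :
    tlift (fun a b => a * S (x' * b)) (comul y') = (counit y' : K) *: S x'.
  move: x' y' => z {}y.
  pose gz z := tlift (fun a b => a * S (z * b)) (comul y).
  have gzE : linfun gz =1 gz.
    apply: linfunE => a u v; rewrite /gz -tlift_linear; apply: tlift_ext => b c.
    by rewrite mulrDl linearD mulrDr -scalerAl linearZ -scalerAr.
  rewrite -/(gz z) -gzE.
  rewrite (antipode_convol_cancel (j := \1%VF)
    (k := fun x => (counit x * counit y : K)%:A)) ?id_lfunE //.
  - transitivity (tlift (fun a b => counit b *: ((counit y : K) *: S a)) (comul z)).
      apply: tlift_ext => a b.
      by rewrite id_lfunE mulr_algr scalerA.
    by rewrite (comul_counitr (GRing.scale (counit y : K) \o S)).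
  - by move=> u v; rewrite !id_lfunE.
  move=> x'; rewrite -counitM -antipoder comulM tlift_mul; last first.
    by split=> [c a u v|c a u v]; rewrite ?linearP ?(mulrDl, mulrDr) -?(scalerAl, scalerAr).
  apply: tlift_ext => a b; rewrite id_lfunE gzE tlift_mull.
  by apply: tlift_ext => c d; rewrite mulrA.
transitivity ((S \o amull x)%VF y); first by rewrite comp_lfunE lfunE.
rewrite (antipode_convol_cancel (j := \1%VF)
    (k := fun y => (counit y : K) *: S x)) ?id_lfunE //.
- transitivity (tlift (fun a b => counit b *: (amulr (S x) \o S)%VF a) (comul y)).
    apply: tlift_ext => a b; rewrite !comp_lfunE !lfunE /=.
    by rewrite scalerAr.
  by rewrite comul_counitr /= comp_lfunE lfunE.
- by move=> u v; rewrite !id_lfunE.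
move=> z; rewrite -step1; apply: tlift_ext => a b.
by rewrite id_lfunE comp_lfunE lfunE.
Qed.

(** The right-hand side is a right convolution inverse of [Delta], of which
    [Delta \o S] is a left inverse: [\sum x_1 S(x_4) (x) x_2 S(x_3)] collapses
    from the inside out. *)
Lemma comul_antipode x :
  comul (S x) = tlift (fun a b => S b *t S a) (comul x).
Proof.
pose g : 'Hom(H, tensor H H) := (tlift (fun a b => S b *t S a) \o comul)%VF.
rewrite -[RHS]/(tlift _ (comul x)) -[RHS]comp_lfunE -/g.
rewrite [RHS](antipode_convol_cancel (j := comul) (g := g)
    (k := fun y => (counit y : K)%:A)); last 3 first.
- exact: comul1.
- exact: comulM.
- move=> y.
  transitivity (tlift (fun a b => tlift (fun c d => comul a * (S d *t S c))
      (comul b)) (comul y)).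
    by apply: tlift_ext => a b; rewrite /g comp_lfunE tlift_mull.
  rewrite -(comul_coassoc (G := fun a c d => comul a * (S d *t S c))); last first.
    by split=> [u v | u v | u v] a z t;
      rewrite linearP ?(tensDl, tensDr, tensZl, tensZr) ?(mulrDl, mulrDr)
        -?(scalerAl, scalerAr).
  transitivity (tlift (fun p d : H => (p * S d) *t (1 : H)) (comul y)).
    apply: tlift_ext => p d.
    transitivity (tlift (U := tensor H H) (fun a c : H =>
        tlift (U := tensor H H) (fun a1 a2 : H => (a1 * S d) *t (a2 * S c))
          (comul a)) (comul p)).
      apply: tlift_ext => a c; rewrite -{1}[comul a]tlift_tens tlift_mulr.
      by apply: tlift_ext => a1 a2; rewrite tensMM.
    rewrite (comul_coassoc (G := fun a1 a2 c : H => (a1 * S d) *t (a2 * S c))); last first.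
      by split=> [u v | u v | u v] a z t;
        rewrite ?linearP ?(mulrDl, mulrDr) -?(scalerAl, scalerAr)
          ?(tensDl, tensDr, tensZl, tensZr).
    transitivity (tlift (fun a b : H =>
        counit b *: (tensl H (1 : H) \o amulr (S d : H))%VF a) (comul p));
      last by rewrite comul_counitr /= comp_lfunE amulrE tenslE.
    apply: tlift_ext => a b; rewrite comp_lfunE amulrE tenslE.
    transitivity ((a * S d) *t ((counit b : K) *: (1 : H))); last exact: tensZr.
    rewrite -antipoder.
    elim/tensor_ind: (comul b) => [v w|s t IHs IHt]; last first.
      by rewrite !linearD /= IHs IHt tensDr.
    by rewrite !tliftE //; split=> [u z t q | u z t q];
        rewrite ?linearP ?(mulrDl, mulrDr) -?(scalerAl, scalerAr)
          ?(tensDl, tensDr, tensZl, tensZr).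
  transitivity (tensl H (1 : H) (tlift (fun p d : H => p * S d) (comul y))).
    by rewrite linear_tlift; apply: tlift_ext => a b; rewrite /= tenslE.
  by rewrite antipoder linearZ /= tenslE.
transitivity (tlift (fun a b => counit b *: (comul \o S)%VF a) (comul x)).
  by rewrite comul_counitr /= comp_lfunE.
by apply: tlift_ext => a b; rewrite comp_lfunE -scalerAr mulr1.
Qed.

End Antipode.

(** * Integrals and injectivity of the antipode *)

Section DualMultiplication.
Variables (K : fieldType) (C : coalgType K).
Implicit Types f g : dual C.

Lemma dualME f g (x : C) :
  (f * g) x = tlift (fun a b => f a * g b : K^o) (comul x).
Proof. exact: dual_mulE. Qed.

Lemma dual_mulZl (k : K) f g : (k *: f) * g = k *: (f * g).
Proof.
have := (dual_mul_bilin C).1 g k f 0; rewrite !addr0 => E; apply: etrans E _.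
by rewrite (mul0r g : dual_mul 0 g = 0) addr0.
Qed.

Lemma dual_mulZr (k : K) f g : f * (k *: g) = k *: (f * g).
Proof.
have := (dual_mul_bilin C).2 f k g 0; rewrite !addr0 => E; apply: etrans E _.
by rewrite (mulr0 f : dual_mul f 0 = 0) addr0.
Qed.

End DualMultiplication.

Section Integrals.
Variables (K : fieldType) (H : hopfType K).
Local Notation S := (@antipode K H).
Implicit Types (f g m : dual H) (h x y : H).

Let e (i : 'I_(\dim {:H})) : H := (vbasis {:H})`_i.
Local Notation c := (@coord_form K H).

(** The product of [H^*] is dual to the coproduct of [H]: in
    [H^* (x) H (x) H], [\sum e^i (x) Delta(e_i) = \sum e^j e^l (x) e_j (x) e_l]. *)
Lemma dual_basis_comul (U : vectType K) (T : dual H -> H -> H -> U) :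
    (forall a b, linear (fun q => T q a b)) ->
  \sum_i tlift (T (c i)) (comul (e i)) = \sum_j \sum_l T (c j * c l) (e j) (e l).
Proof.
move=> TL.
under eq_bigr => i _ do rewrite lfunE /= /tlift_fun.
rewrite exchange_big; apply: eq_bigr => j _ /=.
rewrite exchange_big; apply: eq_bigr => l _ /=.
rewrite -(linfunE (TL (e j) (e l))) [c j * c l]dual_expand linear_sum.
apply: eq_bigr => i _; rewrite linearZ /= (linfunE (TL (e j) (e l))).
by rewrite [(c j * c l) _]dual_mulE pure_form_coord.
Qed.

(** The right action of [H] that makes [H^*] a right Hopf module; it is an action
    because [S] reverses products. *)
Definition dual_act m h : dual H := (m \o amulr (S h))%VF.

Definition dual_translate g h : dual H := (g \o amulr h)%VF.

Lemma dual_actE m h x : dual_act m h x = m (x * S h).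
Proof. by rewrite comp_lfunE amulrE. Qed.

Lemma dual_translateE g h x : dual_translate g h x = g (x * h).
Proof. by rewrite comp_lfunE amulrE. Qed.

Lemma dual_act_bilin : bilin dual_act.
Proof.
split=> [h a m m'|m a h h']; apply/lfunP => x.
  by rewrite !(add_lfunE, scale_lfunE, dual_actE).
by rewrite !(add_lfunE, scale_lfunE, dual_actE) linearP mulrDr -scalerAr linearP.
Qed.

Lemma dual_translate_linear g : linear (dual_translate g).
Proof.
move=> a h h'; apply/lfunP => x.
by rewrite !(add_lfunE, scale_lfunE, dual_translateE) mulrDr -scalerAr linearP.
Qed.

Lemma dual_actM m h h' : dual_act (dual_act m h) h' = dual_act m (h * h').
Proof. by apply/lfunP => x; rewrite !dual_actE antipodeM mulrA. Qed.

Lemma dual_act1 m : dual_act m 1 = m.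
Proof. by apply/lfunP => x; rewrite !dual_actE antipode1 mulr1. Qed.

(** The compatibility of action and coaction in the Hopf module [H^*], the
    coaction being expressed by the left action [g * m] of [H^*] on itself.  At
    [x] the right-hand side is
    [\sum g(x_1 S(h_2) h_3) m(x_2 S(h_1))], since [S] reverses the coproduct. *)
Lemma dual_mul_act g m h :
  g * dual_act m h =
    tlift (fun h1 h2 => dual_act (dual_translate g h2 * m) h1) (comul h).
Proof.
apply/lfunP => x; rewrite dualME tlift_eval.
pose G u v (a b d : H) : K^o := g (u * (S b * d)) * m (v * S a).
have GT u v : trilin (G u v).
  split=> [y z|y z|y z] a p q; rewrite /G.
  - by rewrite linearP mulrDr -scalerAr linearP formDr.
  - by rewrite linearP mulrDl mulrDr -scalerAl -scalerAr linearP formDl.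
  by rewrite !mulrDr -!scalerAr linearP formDl.
have E h1 h2 : (dual_translate g h2 * m) (x * S h1) =
    tlift (fun u v => tlift (fun a b => G u v a b h2) (comul h1)) (comul x).
  rewrite dualME comulM tlift_mul; last first.
    by split=> [z a u v|z a u v]; rewrite linearP ?formDl ?formDr.
  apply: tlift_ext => u v; rewrite comul_antipode linear_tlift.
  apply: tlift_ext => a b; rewrite /= tliftE.
    by rewrite dual_translateE /G mulrA.
  by split=> [z d u' v'|z d u' v'];
    rewrite ?(mulrDl, mulrDr) -?(scalerAl, scalerAr) linearP ?formDl ?formDr.
under [RHS]tlift_ext => h1 h2 do rewrite dual_actE E.
rewrite tlift_exchange; apply: tlift_ext => u v.
rewrite comul_coassoc // -[RHS]/(tlift _ (comul h)).
transitivity (tlift (fun a b => counit b *: (g u * m (v * S a) : K^o)) (comul h)).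
  pose F : 'Hom(H, K^o) := (g u : K) *: (m \o amull v \o S)%VF.
  have FE a : F a = g u * m (v * S a).
    by rewrite scale_lfunE !comp_lfunE amullE.
  under tlift_ext => a b do rewrite -FE.
  by rewrite comul_counitr /= FE dual_actE.
apply: tlift_ext => a b; rewrite /G.
transitivity (g (u * tlift (fun b d => S b * d) (comul b)) * m (v * S a)).
  rewrite antipodel mulr_algr [g (_ *: _)]linearZ.
  exact: mulrA.
rewrite tlift_mull linear_tlift.
pose F : 'Hom(K^o, K^o) := (m (v * S a) : K) *: \1%VF.
have FE t : F t = t * m (v * S a).
  by rewrite scale_lfunE id_lfunE; exact: mulrC.
by rewrite -FE linear_tlift; apply: tlift_ext => b1 b2; rewrite /= FE.
Qed.

(** The projection [m |-> \sum m_0 . S(m_1)] of a Hopf module to its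
    coinvariants, the coaction of [f] being [\sum e^i f (x) e_i]. *)
Definition integral_part f : dual H := \sum_i dual_act (c i * f) (S (e i)).

(** At [x] the left-hand side is [\sum g(x_1 S(x_2))]. *)
Lemma sum_translate_antipode g :
  \sum_j dual_translate g (S (e j)) * c j = (g 1 : K) *: (1 : dual H).
Proof.
apply/lfunP => x; rewrite sum_lfunE scale_lfunE.
transitivity (tlift (fun a b => g (a * S b)) (comul x)).
  rewrite (eq_bigr (fun j => tlift (fun a b => g (a * S (e j)) * c j b : K^o) (comul x))).
    rewrite -tlift_sum; apply: tlift_ext => a b; rewrite {2}(coord_vbasisE b).
    rewrite linear_sum mulr_sumr linear_sum; apply: eq_bigr => j _.
    rewrite linearZ -scalerAr linearZ /= coord_formE; exact: mulrC.
  move=> j _; rewrite dualME; apply: tlift_ext => a b.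
  by rewrite dual_translateE.
by rewrite -linear_tlift antipoder linearZ /=; exact: mulrC.
Qed.

Lemma integral_partP f g : g * integral_part f = (g 1 : K) *: integral_part f.
Proof.
(* The terms of [g * integral_part f], once [comul (S (e i))] is expanded in
   [dual_mul_act], are [tlift (T (c i)) (comul (e i))]. *)
pose T (q : dual H) a b := dual_act (dual_translate g (S a) * (q * f)) (S b).
have TB q : bilin (fun h2 h1 => dual_act (dual_translate g h2 * (q * f)) h1).
  split=> [h a u v|h a u v].
    by rewrite dual_translate_linear mulrDl dual_mulZl dual_act_bilin.1.
  by rewrite dual_act_bilin.2.
transitivity (\sum_j \sum_l T (c j * c l) (e j) (e l)).
  rewrite -dual_basis_comul; last first.
    move=> a b k u v; rewrite /T mulrDl mulrDr dual_mulZl dual_mulZr.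
    exact: dual_act_bilin.1.
  rewrite mulr_sumr; apply: eq_bigr => i _; rewrite dual_mul_act comul_antipode.
  rewrite linear_tlift; apply: tlift_ext => a b; rewrite /= tliftE //.
  by split=> [h k u v|h k u v]; [apply: (TB (c i)).2 | apply: (TB (c i)).1].
rewrite exchange_big scaler_sumr; apply: eq_bigr => l _ /=.
have actD : {morph (dual_act^~ (S (e l))) : p q / p + q >-> p + q}.
  by move=> p q; have := dual_act_bilin.1 (S (e l)) 1 p q; rewrite !scale1r.
have act0 : dual_act 0 (S (e l)) = 0.
  by apply/lfunP => x; rewrite dual_actE !zero_lfunE.
rewrite /T -(big_morph _ actD act0).
under eq_bigr => j _ do rewrite -mulrA mulrA.
rewrite -mulr_suml sum_translate_antipode dual_mulZl mul1r.
by have := dual_act_bilin.1 (S (e l)) (g 1) (c l * f) 0; rewrite !addr0 act0 addr0.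
Qed.

(** The formula [m = \sum m_0 . S(m_1) m_2] in the Hopf module [H^*]: the
    coinvariants generate it. *)
Lemma sum_integral_part f : \sum_l dual_act (integral_part (c l * f)) (e l) = f.
Proof.
pose T (q : dual H) a b := dual_act (q * f) (S a * b).
transitivity (\sum_j \sum_l T (c j * c l) (e j) (e l)).
  rewrite exchange_big; apply: eq_bigr => l _ /=.
  have actD : {morph (dual_act^~ (e l)) : p q / p + q >-> p + q}.
    by move=> p q; have := dual_act_bilin.1 (e l) 1 p q; rewrite !scale1r.
  have act0 : dual_act 0 (e l) = 0.
    by apply/lfunP => x; rewrite dual_actE !zero_lfunE.
  rewrite (big_morph _ actD act0); apply: eq_bigr => j _.
  by rewrite dual_actM mulrA.
rewrite -dual_basis_comul; last first.
  move=> a b k u v; rewrite /T mulrDl dual_mulZl; exact: dual_act_bilin.1.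
rewrite -[RHS]mul1r [X in _ = X * f](dual_expand 1) mulr_suml.
apply: eq_bigr => i _; rewrite dual_mulZl.
pose F : 'Hom(H, dual H) := linfun (dual_act (c i * f)).
have FE a : F a = dual_act (c i * f) a.
  by rewrite /F linfunE //; apply: dual_act_bilin.2.
transitivity (F (tlift (fun a b => S a * b) (comul (e i)))).
  by rewrite linear_tlift; apply: tlift_ext => a b; rewrite /= FE.
by rewrite antipodel linearZ /= FE dual_act1.
Qed.

Lemma exists_integral :
  exists2 lam : dual H, lam != 0 & forall g, g * lam = (g 1 : K) *: lam.
Proof.
have [/existsP[l nz]|] := boolP [exists l, integral_part (c l * 1) != 0].
  by exists (integral_part (c l * 1)) => // g; apply: integral_partP.
rewrite negb_exists => /forallP I0.
(* Otherwise [sum_integral_part] would make the counit vanish. *)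
suff : (1 : dual H) 1 = 0 by rewrite counit1 => /eqP; rewrite oner_eq0.
rewrite -(sum_integral_part 1) sum_lfunE big1 // => l _.
by have := I0 l; rewrite negbK => /eqP ->; rewrite dual_actE zero_lfunE.
Qed.

(** A non-zero integral [lam] has trivial annihilator.  If [lam . h = 0], then
    applying every [g] to the coaction gives [\sum g(h_2) lam . h_1 = 0], whence
    [\sum lam . (h_1 S(h_2)) g(h_3) = g(h) lam] vanishes too.  And [lam . h = 0]
    if [S(h) = 0]. *)
Lemma antipode_inj h : S h = 0 -> h = 0.
Proof.
move=> Sh; have [lam nz lamP] := exists_integral.
have gh0 g : g h = 0.
  (* [Z] is chosen so that [\sum h_1 Z(h_2) = g(h) 1]. *)
  pose Z : 'End(H) := (tlift (fun a b => (g b : K) *: S a) \o comul)%VF.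
  have ZE x : Z x = tlift (fun a b => (g b : K) *: S a) (comul x) by rewrite comp_lfunE.
  pose F : 'Hom(H, dual H) := linfun (dual_act lam).
  have FE a : F a = dual_act lam a.
    by rewrite /F linfunE //; apply: dual_act_bilin.2.
  have lam0 : dual_act lam h = 0.
    by apply/lfunP => x; rewrite dual_actE Sh mulr0 linear0 zero_lfunE.
  (* Summing against the basis replaces [e^l(h_2) Z(e_l)] by [Z(h_2)]. *)
  have sum0 : \sum_l dual_act (c l * dual_act lam h) (Z (e l)) = 0.
    rewrite lam0 big1 // => l _; rewrite mulr0.
    by apply/lfunP => x; rewrite dual_actE !zero_lfunE.
  have : (g h : K) *: lam = 0.
    rewrite -sum0.
    transitivity (F (tlift (fun a b => a * Z b) (comul h))).
      transitivity (F ((g h : K) *: (1 : H))).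
        by rewrite linearZ /= FE dual_act1.
      congr (F _).
      transitivity (tlift (fun a b => tlift (fun b1 b2 =>
          (g b2 : K) *: (a * S b1)) (comul b)) (comul h)); last first.
        apply: tlift_ext => a b; rewrite ZE tlift_mull; apply: tlift_ext => b1 b2.
        by rewrite scalerAr.
      rewrite -(comul_coassoc (G := fun a b1 b2 => (g b2 : K) *: (a * S b1))); last first.
        split=> [u v|u v|u v] a y z.
        + by rewrite mulrDl scalerDr -scalerAl !scalerA mulrC.
        + by rewrite linearP mulrDr scalerDr -scalerAr !scalerA mulrC.
        by rewrite linearP /= scalerDl scalerA.
      pose L : 'End(H) := linfun (fun b => (g b : K) *: (1 : H)).
      have LE b : L b = (g b : K) *: 1.
        by rewrite /L linfunE // => k u v; rewrite linearP scalerDl scalerA.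
      rewrite -LE -(comul_counitl L); apply: tlift_ext => a b /=.
      rewrite LE scalerA mulrC -scalerA.
      transitivity ((g b : K) *: tlift (fun a1 a2 => a1 * S a2) (comul a)).
        by rewrite antipoder.
      exact: (linear_tlift (GRing.scale (g b : K))).
    rewrite linear_tlift; transitivity (tlift (fun h1 h2 =>
        \sum_l (c l h2 : K) *: F (h1 * Z (e l))) (comul h)).
      apply: tlift_ext => a b /=; rewrite {1}(coord_vbasisE b) linear_sum.
      rewrite mulr_sumr linear_sum; apply: eq_bigr => l _.
      by rewrite linearZ -scalerAr linearZ /= coord_formE.
    rewrite tlift_sum; apply: eq_bigr => l _; rewrite dual_mul_act.
    pose A : 'End(dual H) := linfun (dual_act^~ (Z (e l))).
    have AE m : A m = dual_act m (Z (e l)).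
      by rewrite /A linfunE //; apply: dual_act_bilin.1.
    rewrite -AE linear_tlift; apply: tlift_ext => h1 h2 /=.
    rewrite AE lamP dual_translateE mul1r FE -dual_actM.
    have E k m h' : dual_act (k *: m) h' = k *: dual_act m h'.
      by apply/lfunP => x; rewrite !(dual_actE, scale_lfunE).
    by rewrite !E.
  move/eqP; rewrite scaler_eq0 (negPf nz) orbF => /eqP; exact.
rewrite (coord_vbasisE h) big1 // => i _.
by have := gh0 (c i); rewrite coord_formE => ->; rewrite scale0r.
Qed.

End Integrals.

(** * The shear map and the transpose of the Galois map *)

Section GaloisMap.
Variables (K : fieldType) (H : hopfType K).
Local Notation S := (@antipode K H).

Definition shear : 'End(tensor H H) :=
  tlift (fun h c : H => ((1 : H) *t h) * comul c).

Lemma shearE h c : shear (h *t c) = ((1 : H) *t h) * comul c.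
Proof.
apply: tliftE; split=> [w a u v|v a w w'].
  by rewrite tensDr tensZr mulrDl -scalerAl.
by rewrite linearP mulrDr -scalerAr.
Qed.

(** Applying [S] to the second factor of [\sum c_1 (x) h c_2], and then
    [W : x (x) y |-> \sum x_1 (x) x_2 y], gives
    [\sum c_1 (x) c_2 S(c_3) S(h) = c (x) S(h)], which determines [c (x) h] as [S] is
    injective. *)
Lemma shear_inj t : shear t = 0 -> t = 0.
Proof.
pose W : 'End(tensor H H) := tlift (fun x y : H => comul x * ((1 : H) *t y)).
have WE x y : W (x *t y) = comul x * ((1 : H) *t y).
  apply: tliftE; split=> [w a u v|v a w w'].
    by rewrite linearP mulrDl -scalerAl.
  by rewrite tensDr tensZr mulrDr -scalerAr.
have Sinj : lker S == 0%VS.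
  by apply/lker0P => x y Sxy; apply/subr0_eq/antipode_inj; rewrite linearB /= Sxy subrr.
(* [R] is the inverse of [h (x) c |-> c (x) S h]. *)
pose R : 'End(tensor H H) := tlift (fun c h : H => (S^-1)%VF h *t c).
have RE c h : R (c *t h) = (S^-1)%VF h *t c.
  apply: tliftE; split=> [w a u v|v a w w'].
    by rewrite tensDr tensZr.
  by rewrite linearP tensDl tensZl.
suff sK : R (W (tmap \1%VF S (shear t))) = t by move=> s0; rewrite -sK s0 !linear0.
elim/tensor_ind: t => [h c|s t IHs IHt]; last by rewrite !linearD /= IHs IHt.
rewrite shearE -[h in RHS](lker0_lfunK Sinj) -RE; congr (R _).
transitivity (tlift (fun a b => tlift (fun a1 a2 : H => a1 *t (a2 * (S b * S h)))
    (comul a)) (comul c)).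
  rewrite -{1}[comul c]tlift_tens tlift_mull.
  rewrite (linear_tlift (tmap \1%VF S)) (linear_tlift W).
  apply: tlift_ext => a b; rewrite /= tensMM mul1r tmapE id_lfunE WE antipodeM.
  rewrite -{1}[comul a]tlift_tens tlift_mulr; apply: tlift_ext => a1 a2.
  by rewrite tensMM mulr1.
rewrite (comul_coassoc (G := fun a1 a2 b : H => a1 *t (a2 * (S b * S h)))); last first.
  split=> [u v|u v|u v] a y z.
  - by rewrite tensDl tensZl.
  - by rewrite mulrDl -scalerAl tensDr tensZr.
  by rewrite linearP mulrDl mulrDr -scalerAl -scalerAr tensDr tensZr.
transitivity (tlift (fun a b => counit b *: tensl H (S h) a) (comul c)); last first.
  by rewrite comul_counitr /= tenslE.
apply: tlift_ext => a b; rewrite tenslE.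
transitivity (a *t ((counit b : K) *: S h)); last exact: tensZr.
rewrite -mulr_algl -antipoder tlift_mulr.
rewrite -tensrE linear_tlift; apply: tlift_ext => b1 b2.
by rewrite /= tensrE mulrA.
Qed.

Lemma shear_bij : bijective shear.
Proof. exact: inj_hom_bij shear_inj. Qed.

(** The Galois map is the transpose of [h (x) c |-> \sum c_1 (x) h c_2]. *)
Lemma tpair_galois (C : modCoalgType H) (t : tensor (dual C) (dual C)) (h : H) (c : C) :
  tpair (galois_map C t) h c = tlift (fun u v => tpair t u (act h v)) (comul c).
Proof.
have DB (X : coalgType K) : bilin (fun f g : dual X => f * g).
  exact: dual_mul_bilin.
elim/tensor_ind: t => [a b|s t IHs IHt]; last first.
  transitivity (tpair (galois_map C s) h c + tpair (galois_map C t) h c).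
    by rewrite /tpair !linearD.
  rewrite IHs IHt -[X in X + _]scale1r -tlift_linear; apply: tlift_ext => u v.
  by rewrite scale1r /tpair linearD.
rewrite galois_mapE.
transitivity (tlift (fun u v => a u * tpair (coaction b) h v : K^o) (comul c)).
  elim/tensor_ind: (coaction b) => [f g|s t IHs IHt].
    have -> : dual_tmul ((1 : dual H) *t a) (f *t g) = (1 * f) *t (a * g).
      by apply: tmap2E; apply: DB.
    transitivity ((1 * f) h * (a * g) c); first exact: tpairE.
    rewrite mul1r.
    transitivity ((f h : K) *: tlift (fun u v => a u * g v : K^o) (comul c)).
      by congr (_ * _); exact: dual_mulE.
    rewrite (linear_tlift (GRing.scale (f h : K))); apply: tlift_ext => u v /=.
    by rewrite tpairE; exact: mulrCA.
  have -> : dual_tmul ((1 : dual H) *t a) (s + t) =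
      dual_tmul ((1 : dual H) *t a) s + dual_tmul ((1 : dual H) *t a) t.
    by apply: tmap2Dr; apply: DB.
  rewrite /tpair linearD /= -!/(tpair _ _ _) IHs IHt.
  rewrite -[X in X + _]scale1r -tlift_linear; apply: tlift_ext => u v.
  by rewrite scale1r linearD /= -mulrDr.
by apply: tlift_ext => u v; rewrite coactionE tpairE.
Qed.

End GaloisMap.

(** * Module coalgebras with a normalized generator *)

Section RegularModuleCoalgebra.
Variables (K : fieldType) (H : hopfType K) (C : modCoalgType H).

(* [j 1] is a generator of [C] normalized by [eps_C (j 1) = 1]. *)
Variables (j : 'Hom(H, C)) (J : tensor H H).
Hypothesis j_bij : bijective j.
Hypothesis j_act : forall x y : H, j (x * y) = act x (j y).
Hypothesis j_counit : forall x : H, counit (j x) = counit x :> K.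
Hypothesis j_comul1 : comul (j 1) = tmap j j J.

Let i : 'Hom(C, H) := (j^-1)%VF.

Let jK : cancel j i.
Proof. by apply: lker0_lfunK; apply/lker0P; apply: bij_inj. Qed.

Let iK : cancel i j.
Proof. by move=> c; have [g gK Kg] := j_bij; rewrite -[c]Kg jK. Qed.

Let tjK : cancel (tmap j j) (tmap i i).
Proof. exact: tmapK. Qed.

Let tiK : cancel (tmap i i) (tmap j j).
Proof. exact: tmapK. Qed.

Let j1_act h : j h = act h (j 1).
Proof. by rewrite -j_act mulr1. Qed.

Lemma comul_regular h : comul (j h) = tmap j j (comul h * J).
Proof.
rewrite j1_act comul_act j_comul1.
have aB : bilin (fun (g : H) (d : C) => act g d).
  split=> [w a u v|v a u w]; last by rewrite linearP.
  by rewrite linearP add_lfunE scale_lfunE.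
elim/tensor_ind: (comul h) => [a b|s t IHs IHt]; last first.
  by rewrite tmap2Dl // IHs IHt mulrDl linearD.
elim/tensor_ind: J => [a' b'|s t IHs IHt]; last first.
  by rewrite linearD /= tmap2Dr // IHs IHt mulrDr linearD.
by rewrite tensMM !tmapE tmap2E // !j_act.
Qed.

(** Read through [j], the transpose of the Galois map is the shear followed by
    right multiplication by [J]. *)
Lemma galois_pairing (t : tensor (dual C) (dual C)) (r : tensor H H) :
  tlift (tpair (galois_map C t)) (tmap \1%VF j r) =
    tlift (tpair t) (tmap j j (shear H r * J)).
Proof.
elim/tensor_ind: r => [h c|s s' IHs IHs']; last first.
  by rewrite !linearD /= mulrDl !linearD /= IHs IHs'.
rewrite tmapE id_lfunE tliftE; last exact: tpair_bilin.
rewrite tpair_galois comul_regular shearE -mulrA.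
elim/tensor_ind: (comul c * J) => [a b|s s' IHs IHs']; last first.
  by rewrite mulrDr !linearD /= IHs IHs'.
rewrite tensMM mul1r !tmapE j_act.
rewrite (tliftE _ _ (tpair_bilin t)) tliftE //.
by split=> [w k u v|v k u w]; rewrite ?linearP ((tpair_bilin t).1, (tpair_bilin t).2).
Qed.

(** The composite in [galois_pairing] is onto, so the Galois map is injective; its
    source and target have the same dimension. *)
Lemma unit_galois_bij : J \is a GRing.unit -> bijective (galois_map C).
Proof.
move=> JU; apply: inj_hom_bij => [|t t0].
  have dimC : \dim {:C} = \dim {:H}.
    rewrite -(limg_dim_eq (f := j)); first congr (\dim _).
      by apply/eqP; rewrite eqEsubv subvf andbT; apply/subvP => c _;
        rewrite -[c]iK memv_img ?memvf.
    suff /eqP -> : lker j == 0%VS by rewrite capv0.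
    by apply/lker0P; apply: bij_inj.
  by rewrite !dim_tensor !dim_dual dimC.
apply: tpair_inj => u v; rewrite -(tliftE _ _ (tpair_bilin t)).
have [g gK Kg] := shear_bij H.
(* Every tensor is [tmap j j (shear H r * J)] for some [r]. *)
rewrite -[_ *t _]tiK -(mulrVK JU (tmap i i _)) -(Kg (_ / _)) -galois_pairing t0.
elim/tensor_ind: (tmap _ _ _) => [h c|s s' IHs IHs'].
  by rewrite (tliftE _ _ (tpair_bilin _)) /tpair linear0.
by rewrite linearD /= IHs IHs' addr0.
Qed.

(** If [s J = 0], then the preimage of [s] under the shear is orthogonal to the
    image of the Galois map, which is everything. *)
Lemma galois_bij_unit : bijective (galois_map C) -> J \is a GRing.unit.
Proof.
move=> [g gK Kg]; apply: inj_amulr_unit => s s0.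
have [d _ Kd] := shear_bij H.
rewrite -[s]Kd; suff -> : d s = 0 by rewrite linear0.
have oneK (X : vectType K) : cancel (\1%VF : 'End(X)) (\1%VF : 'End(X)).
  by move=> x; rewrite !id_lfunE.
rewrite -(tmapK (oneK H) jK (d s)).
suff -> : tmap \1%VF j (d s) = 0 by rewrite linear0.
apply: tpair_inj_r => t; rewrite -[t]Kg galois_pairing Kd s0.
by rewrite !linear0.
Qed.

(** A coinvariant form satisfies [a (h . j 1) = eps(h) a (j 1)], so it is
    [a (j 1)] times the counit. *)
Lemma regular_coinvariants (a : dual C) :
  coaction a = (1 : dual H) *t a <-> a \in <[1 : dual C]>%VS.
Proof.
split=> [ca|/vlineP[k ->]].
  have aE h c : a (act h c) = counit h * a c.
    by rewrite -coactionE ca tpairE.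
  apply/vlineP; exists (a (j 1)); apply/lfunP => c.
  rewrite scale_lfunE -[c]iK j1_act aE -j1_act.
  rewrite -[(1 : dual C) _]/(counit _) j_counit; exact: mulrC.
symmetry; apply: coaction_unique => h c; rewrite tpairE !scale_lfunE.
rewrite -[(1 : dual C) (act h c)]/(counit _) counit_act; exact: mulrCA.
Qed.

Lemma unit_is_galois : J \is a GRing.unit -> is_galois C.
Proof. by move=> JU; split; [exact: regular_coinvariants | exact: unit_galois_bij]. Qed.

(** Coassociativity of [C] at [j 1], pulled back along [j (x) j (x) j]. *)
Lemma regular_cocycle :
  tassoc H H H (tmap comul \1%VF J * (J *t (1 : H))) =
    tmap \1%VF comul J * ((1 : H) *t J).
Proof.
apply: (can_inj (tmapK jK tjK)).
have lE t : tmap comul \1%VF (tmap j j t) =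
    tmap (tmap j j) j (tmap comul \1%VF t * (J *t (1 : H))).
  elim/tensor_ind: t => [a b|s t IHs IHt]; last by rewrite !linearD /= IHs IHt mulrDl linearD.
  by rewrite !tmapE tensMM mulr1 tmapE !id_lfunE comul_regular.
have rE t : tmap \1%VF comul (tmap j j t) =
    tmap j (tmap j j) (tmap \1%VF comul t * ((1 : H) *t J)).
  elim/tensor_ind: t => [a b|s t IHs IHt]; last by rewrite !linearD /= IHs IHt mulrDl linearD.
  by rewrite !tmapE tensMM mulr1 tmapE !id_lfunE comul_regular.
have aE s : tassoc C C C (tmap (tmap j j) j s) = tmap j (tmap j j) (tassoc H H H s).
  elim/tensor_ind: s => [x c|s t IHs IHt]; last by rewrite !linearD /= IHs IHt.
  elim/tensor_ind: x => [x y|s t IHs IHt]; last by rewrite tensDl !linearD /= IHs IHt.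
  by rewrite tassocE !tmapE tassocE.
by rewrite -aE -lE -rE -j_comul1 comulA.
Qed.

Lemma regular_counitl : tforml H counit J = 1.
Proof.
apply: (bij_inj j_bij); rewrite -[RHS]counitl j_comul1.
elim/tensor_ind: J => [a b|s t IHs IHt]; last by rewrite !linearD /= IHs IHt.
by rewrite tmapE !tformlE linearZ j_counit.
Qed.

Lemma regular_counitr : tformr H counit J = 1.
Proof.
apply: (bij_inj j_bij); rewrite -[RHS]counitr j_comul1.
elim/tensor_ind: J => [a b|s t IHs IHt]; last by rewrite !linearD /= IHs IHt.
by rewrite tmapE !tformrE linearZ j_counit.
Qed.

Lemma regular_is_twist : is_galois C -> is_twist J.
Proof.
move=> [_ gB]; split; [exact: galois_bij_unit | exact: regular_cocycle
  | exact: regular_counitl | exact: regular_counitr].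
Qed.

Lemma regular_twisted_iso (J' : twist H) :
  twist_val J' = J -> modcoalg_iso (twisted J') C.
Proof.
move=> JE; exists (j : 'Hom(twisted J', C)); split=> // [h c|c].
  by rewrite act_twistedE j_act.
by rewrite comul_regular comul_twistedE JE.
Qed.

End RegularModuleCoalgebra.

(** * The correspondence *)

Section Correspondence.
Variables (K : fieldType) (H : hopfType K).

Lemma twist_val_inj : injective (@twist_val K H).
Proof.
(* All conditions on a twist are equations in types with decidable equality. *)
case=> J [u c l r] [J' [u' c' l' r']] /= JJ; subst J'.
by rewrite (eq_irrelevance u u') (eq_irrelevance c c') (eq_irrelevance l l')
  (eq_irrelevance r r').
Qed.

(** As [i^-1 1] generates [C], the counit of [C] would vanish identically, and by
    the counit axiom so would [C]. *)
Lemma regular_counit_neq0 (C : modCoalgType H) (i : 'Hom(C, H)) :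
  regular_iso i -> counit ((i^-1)%VF 1) != 0 :> K.
Proof.
move=> [i_bij i_act]; apply/eqP => e0.
have iK : cancel i i^-1%VF by apply: lker0_lfunK; apply/lker0P; apply: bij_inj.
have Ki : cancel i^-1%VF i by move=> h; have [g gK Kg] := i_bij; rewrite -[h]Kg iK.
have eps0 : (counit : dual C) = 0.
  apply/lfunP => c; rewrite zero_lfunE -[c]iK.
  have -> : (i^-1)%VF (i c) = act (i c) ((i^-1)%VF 1).
    by apply: (bij_inj i_bij); rewrite i_act !Ki mulr1.
  by rewrite counit_act e0 mulr0.
have := oner_neq0 H; rewrite -[1 in X in X -> _]Ki -(counitl (i^-1%VF 1)) eps0.
case/eqP; rewrite -[RHS](linear0 i); congr (i _).
elim/tensor_ind: (comul _) => [v w|s t IHs IHt]; last by rewrite linearD /= IHs IHt addr0.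
by rewrite tformlE zero_lfunE scale0r.
Qed.

(** Dividing the generator [i^-1 1] by its counit [s] makes it normalized, and
    multiplies the associated tensor by [s^-1 / (s^-1)^2 = s]. *)
Lemma regular_frame (C : modCoalgType H) (i : 'Hom(C, H)) :
    regular_iso i ->
  exists s : K, exists j : 'Hom(H, C),
    [/\ s != 0, bijective j, forall x y : H, j (x * y) = act x (j y),
        forall x : H, counit (j x) = counit x :> K
      & comul (j 1) = tmap j j (s *: tmap i i (comul ((i^-1)%VF (1 : H))))].
Proof.
move=> iR; have e0 := regular_counit_neq0 iR; have [i_bij i_act] := iR.
have iK : cancel i i^-1%VF by apply: lker0_lfunK; apply/lker0P; apply: bij_inj.
have Ki : cancel i^-1%VF i by move=> h; have [g gK Kg] := i_bij; rewrite -[h]Kg iK.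
set s : K := counit _ in e0; exists s; exists (s^-1 *: (i^-1)%VF).
have iact x y : (i^-1)%VF (x * y) = act x ((i^-1)%VF y).
  by apply: (bij_inj i_bij); rewrite i_act !Ki.
split=> // [|x y|x|].
- exists (s *: i) => x; rewrite !scale_lfunE linearZ /= scalerA ?mulfV ?mulVf //.
    by rewrite scale1r Ki.
  by rewrite scale1r iK.
- by rewrite !scale_lfunE iact linearZ.
- rewrite scale_lfunE -[x in (i^-1)%VF x]mulr1 iact linearZ /= counit_act -/s.
  by rewrite -[LHS]/(_ * (_ * _)) mulrCA mulVf // mulr1.
by rewrite scale_lfunE linearZ linearZ /= tmapZ (tmapK iK iK) scalerA
  mulrA mulfV // mul1r.
Qed.

(** Only one multiple of a tensor can be normalized. *)
Lemma normalized_scale_eq (J : twist H) (X : tensor H H) (s s' : K) :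
    tforml H counit (s *: X) = 1 -> twist_val J = s' *: X ->
  twist_val J = s *: X.
Proof.
move=> sX JX; have [_ _ Jl _] := twistP J; rewrite JX; congr (_ *: _).
have sT : s *: tforml H counit X = 1 by rewrite -sX linearZ.
have sT' : s' *: tforml H counit X = 1 by rewrite -Jl JX linearZ.
have : s' *: (s *: tforml H counit X) = s *: (s' *: tforml H counit X).
  by rewrite !scalerA mulrC.
rewrite sT sT' => /eqP.
by rewrite -subr_eq0 -scalerBl scaler_eq0 oner_eq0 orbF subr_eq0 => /eqP.
Qed.

Lemma twist_from_iso (C : modCoalgType H) (i : 'Hom(C, H)) (J : twist H) :
  regular_iso i -> twist_from i J -> modcoalg_iso (twisted J) C.
Proof.
move=> iR [s' _ JE]; have [s [j [s0 jB ja je jc]]] := regular_frame iR.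
apply: (regular_twisted_iso jB ja je jc).
exact: normalized_scale_eq (regular_counitl jB je jc) JE.
Qed.

Lemma twist_from_unique_exists (C : modCoalgType H) (i : 'Hom(C, H)) :
  is_galois C -> regular_iso i -> exists! J : twist H, twist_from i J.
Proof.
move=> CG iR; have [s [j [s0 jB ja je jc]]] := regular_frame iR.
exists (Twist (regular_is_twist jB ja je jc CG)); split; first by exists s.
move=> J [s' _ JE]; apply: twist_val_inj; symmetry.
exact: normalized_scale_eq (regular_counitl jB je jc) JE.
Qed.

Lemma id_bij (V : vectType K) : bijective (\1%VF : 'End(V)).
Proof. by exists id => v; rewrite id_lfunE. Qed.

Lemma twisted_galois (J : twist H) : regular_galois (twisted J).
Proof.
have [JU _ _ _] := twistP J.
split.
  exists (\1%VF : 'Hom(twisted J, H)); split; first exact: id_bij.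
  by move=> h c; rewrite !id_lfunE act_twistedE.
apply: (@unit_is_galois _ H (twisted J) (\1%VF : 'Hom(H, H)) (twist_val J)) => //.
- exact: id_bij.
- by move=> x y; rewrite !id_lfunE act_twistedE.
- by move=> x; rewrite id_lfunE.
rewrite id_lfunE comul_twistedE comul1 -[_ *t _]/(1 : tensor H H) mul1r.
elim/tensor_ind: (twist_val J) => [a b|s t IHs IHt]; last by rewrite linearD /= -IHs -IHt.
by rewrite tmapE !id_lfunE.
Qed.

Lemma tmap_amulr (x : H) t : tmap (amulr x) (amulr x) t = t * (x *t x).
Proof.
elim/tensor_ind: t => [a b|s t IHs IHt]; last by rewrite linearD /= IHs IHt mulrDl.
by rewrite tmapE !amulrE tensMM.
Qed.

(** Right multiplication by [x^-1] is an isomorphism: it carries [Delta(c) J] to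
    [Delta(c) J (x^-1 (x) x^-1) = Delta(c x^-1) J']. *)
Lemma gauge_twisted_iso (J J' : twist H) :
  gauge_equiv J J' -> modcoalg_iso (twisted J) (twisted J').
Proof.
move=> [x [xU x1 JE]].
have fE c : (amulr x^-1 : 'Hom(twisted J, twisted J')) c = c * x^-1 :> H.
  exact: amulrE.
exists (amulr x^-1 : 'Hom(twisted J, twisted J')); split=> [|h c|c|c].
- by exists (fun c : H => c * x) => c; rewrite fE ?mulrVK ?mulrK.
- by rewrite fE !act_twistedE fE mulrA.
- rewrite fE !comul_twistedE [LHS]tmap_amulr JE comulM.
  by rewrite !mulrA -[X in _ = X * _ * _]mulrA -comulM mulVr // comul1
    -[(1 : H) *t 1]/(1 : tensor H H) mulr1.
rewrite fE !counit_twistedE counitM.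
have <- : counit (x * x^-1) = (counit (x^-1) : K) by rewrite counitM x1 mul1r.
by rewrite mulrV // counit1 mulr1.
Qed.

(** An isomorphism is right multiplication by [x = f 1], and compatibility with the
    coproducts at [1] reads [J (x (x) x) = Delta(x) J']. *)
Lemma twisted_iso_gauge (J J' : twist H) :
  modcoalg_iso (twisted J) (twisted J') -> gauge_equiv J J'.
Proof.
move=> [f [fB fa fD fe]]; pose x : H := f (1 : H).
have fE (c : H) : f c = c * x :> H.
  by rewrite -[c in LHS]mulr1 -[c * 1](act_twistedE J) fa act_twistedE.
have xU : x \is a GRing.unit.
  apply: inj_amulr_unit => v vx0; apply: (bij_inj fB).
  by rewrite [LHS]fE vx0 linear0.
have Jx : twist_val J * (x *t x) = comul x * twist_val J'.
  rewrite -[RHS](comul_twistedE J') -[comul _](fD (1 : H)).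
  rewrite comul_twistedE comul1 -[(1 : H) *t 1]/(1 : tensor H H) mul1r.
  rewrite -tmap_amulr; congr (_ _); congr (tmap _ _); apply/lfunP => c;
  by rewrite [RHS]fE amulrE.
exists x^-1; split; first by rewrite unitrV.
  have x1 : counit x = 1 :> K by rewrite [LHS]fe counit1.
  have : counit (x * x^-1) = 1 :> K by rewrite mulrV // counit1.
  by rewrite counitM x1 mul1r.
rewrite invrK -mulrA Jx mulrA -comulM mulVr // comul1.
by rewrite -[(1 : H) *t 1]/(1 : tensor H H) mul1r.
Qed.

End Correspondence.

Theorem proposition4p2 (k : closedFieldType) (H : hopfType k) :
  (* (a) is a well-defined map on classes *)
  (forall J : twist H, regular_galois (twisted J)) /\
  (forall J J' : twist H,
     gauge_equiv J J' -> modcoalg_iso (twisted J) (twisted J')) /\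
  (* (b) is a well-defined map on classes *)
  (forall (C : modCoalgType H) (i : 'Hom(C, H)),
     regular_galois C -> regular_iso i -> exists! J : twist H, twist_from i J) /\
  (forall (C C' : modCoalgType H) (i : 'Hom(C, H)) (i' : 'Hom(C', H))
      (J J' : twist H),
     regular_galois C -> regular_galois C' -> modcoalg_iso C C' ->
     regular_iso i -> regular_iso i' -> twist_from i J -> twist_from i' J' ->
     gauge_equiv J J') /\
  (* the maps induced by (a) and (b) are mutually inverse *)
  (forall (J J' : twist H) (i : 'Hom(twisted J, H)),
     regular_iso i -> twist_from i J' -> gauge_equiv J J') /\
  (forall (C : modCoalgType H) (i : 'Hom(C, H)) (J : twist H),
     regular_galois C -> regular_iso i -> twist_from i J ->
     modcoalg_iso (twisted J) C).
Proof.
split; first exact: twisted_galois.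
split; first exact: gauge_twisted_iso.
split; first by move=> C i [_ CG]; apply: twist_from_unique_exists.
split.
  move=> C C' i i' J J' _ _ CC' iR iR' Ji Ji'; apply: twisted_iso_gauge.
  apply: modcoalg_iso_trans (twist_from_iso iR Ji) _.
  apply: modcoalg_iso_trans CC' _.
  exact/modcoalg_iso_sym/(twist_from_iso iR' Ji').
split=> [J J' i iR iJ|C i J _]; last exact: twist_from_iso.
exact/twisted_iso_gauge/modcoalg_iso_sym/(twist_from_iso iR iJ).
Qed.
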